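(* Let $N\ge 2$, $\omega\in\mathbb{R}$, and let $\mathbf{H}$ be a directed graph on $\{1,\dots,N\}$ without self-loops that admits a spanning diverging tree. Then there is a coupling function $\mathrm{g}$ such that the all-to-all coupled oscillator network $$\dot\theta_k=\omega+\sum_{j=1,\,j\ne k}^N \mathrm{g}(\theta_j-\theta_k),\qquad k=1,\dots,N,$$ on $\mathbb{T}^N$ has a locally asymptotically stable relative equilibrium $(\Omega t+\theta^o_1,\dots,\Omega t+\theta^o_N)$ (for some $\Omega\in\mathbb{R}$, $\theta^o\in\mathbb{T}^N$) satisfying $\mathcal{G}_{\mathrm{g}}(\theta^o)=\mathbf{H}$. In other words, there exists a coupling function $\mathrm{g}$ that stably realises $\mathbf{H}$.
   Context: $\mathbb{T}=\mathbb{R}/2\pi\mathbb{Z}$. A coupling function is a non-constant smooth function $\mathrm{g}:\mathbb{T}\to\mathbb{R}$. Let $\mathrm{LC}(\mathrm{g})$ be the set of points of $\mathbb{T}$ having an open neighbourhood on which $\mathrm{g}$ is constant, and $\mathrm{DZ}(\mathrm{g})$ the set of points having an open neighbourhood on which $\mathrm{g}\equiv 0$. All coupling functions are assumed to have simple dead zones: $\mathrm{DZ}(\mathrm{g})$ has finitely many connected components and $\mathrm{LC}(\mathrm{g})=\mathrm{DZ}(\mathrm{g})$. The effective coupling graph $\mathcal{G}_{\mathrm{g}}(\theta)$ at $\theta\in\mathbb{T}^N$ is the directed graph on $\{1,\dots,N\}$ with edge set $\{(j,k): j\neq k,\ \theta_j-\theta_k\notin\mathrm{DZ}(\mathrm{g})\}$,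 where $(j,k)$ is an edge from $j$ to $k$. Put $\Theta_{\mathrm{g}}(\mathbf{H})=\{\theta\in\mathbb{T}^N:\mathcal{G}_{\mathrm{g}}(\theta)=\mathbf{H}\}$. A spanning diverging tree of a directed graph is a subgraph containing all vertices, whose underlying undirected graph is connected, such that one node (the root) has no incoming edges and every other node has exactly one incoming edge. The network is equivariant under the phase shifts $(\theta_1,\dots,\theta_N)\mapsto(\theta_1+\phi,\dots,\theta_N+\phi)$, $\phi\in\mathbb{T}$. A relative equilibrium is a solution of the form $(\Omega t+\theta^o_1,\dots,\Omega t+\theta^o_N)$, i.e. an equilibrium of the quotient system by phase shifts (phase-difference coordinates); it is locally asymptotically stable if the corresponding equilibrium of the quotient system is asymptotically stable. $\mathbf{H}$ is stably realised by $\mathrm{g}$ if there is a nonempty, (forward-)invariant, asymptotically stable open set $B\subset\mathbb{T}^N$ with $B\subset\Theta_{\mathrm{g}}(\mathbf{H})$. *)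

(* Defs.v *)
From HB Require Import structures.
From mathcomp Require Import all_boot all_order all_algebra.
From mathcomp Require Import all_classical all_reals all_analysis.

Set Implicit Arguments.
Unset Strict Implicit.
Unset Printing Implicit Defensive.
Import Order.TTheory GRing.Theory Num.Theory.
Import numFieldNormedType.Exports.

Local Open Scope classical_set_scope.
Local Open Scope ring_scope.
Local Open Scope quotient_scope.

Section circle.
Variable R : realType.

Definition period : {pred R} :=
  fun x => `[< exists m : int, x = m%:~R * (2 * pi) >].

Fact period_zmod_closed : zmod_closed period.
Proof.
split; first by apply/asboolP; exists 0; rewrite mul0r.
move=> _ _ /asboolP[m ->] /asboolP[k ->].
by apply/asboolP; exists (m - k); rewrite intrB mulrBl.
Qed.

HB.instance Definition _ := GRing.isZmodClosed.Build R period period_zmod_closed.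

Definition circle : Type := Quotient.quot (period : zmodClosed R).

HB.instance Definition _ := ZmodQuotient.on circle.

Definition to_circle (x : R) : circle := \pi_circle x.

(* This is the topology of [quotient_topology], which cannot be copied here
   because it comes with another choice structure than that of the group. *)
Definition circle_open (U : set circle) := open (to_circle @^-1` U).

Fact circle_openT : circle_open setT.
Proof. exact: openT. Qed.

Fact circle_openI : setI_closed circle_open.
Proof. by move=> U V; exact: openI. Qed.

Fact circle_open_bigcup (I : Type) (f : I -> set circle) :
  (forall i, circle_open (f i)) -> circle_open (\bigcup_i f i).
Proof. by move=> oU; apply: bigcup_open => i _; exact: oU. Qed.

HB.instance Definition _ := @isOpenTopological.Build circle
  circle_open circle_openT circle_openI circle_open_bigcup.

End circle.

Notation torus R m := {ptws 'I_m -> circle R}.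

Section coupling_function.
Variable R : realType.
Implicit Type g : circle R -> R.

Definition smooth g :=
  forall n x, derivable (derive1n n (g \o @to_circle R)) x 1.

Definition LC g : set (circle R) := [set x | \forall y \near x, g y = g x].

Definition DZ g : set (circle R) := [set x | \forall y \near x, g y = 0].

Definition simple_dead_zones g :=
  finite_set [set connected_component (DZ g) x | x in DZ g] /\ LC g = DZ g.

Definition coupling_function g :=
  [/\ smooth g, ~ (exists c, forall x, g x = c) & simple_dead_zones g].

End coupling_function.

Section digraph.
Variable T : finType.
Implicit Types H A : rel T.

(* [A j k] means that there is an edge from j to k. *)
Definition spanning_diverging_tree H A :=
  [/\ subrel A H,
      forall j k, connect [rel x y | A x y || A y x] j k
    & exists r, (forall j, ~~ A j r) /\
        forall k, k != r -> #|[set j | A j k]%SET| = 1%N].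

End digraph.

Section dynamics.
Variables (R : realType) (m : nat).
Implicit Types (F : torus R m -> 'I_m -> R) (A : set (torus R m)).

(* A curve in the torus is differentiated through a lift to R^m. All vector
   fields of interest are smooth on a compact manifold, hence complete, so
   that solutions may be taken to be defined on the whole line. *)
Definition solution F (theta : R -> torus R m) :=
  exists x : R -> 'I_m -> R,
    (forall t k, theta t k = to_circle (x t k)) /\
    (forall t k, is_derive t (1 : R) (fun s => x s k) (F (theta t) k)).

Definition forward_invariant F A :=
  forall theta, solution F theta -> A (theta 0) ->
  forall t, 0 <= t -> A (theta t).

Definition lyapunov_stable F A :=
  forall U, open U -> A `<=` U ->
  exists V, [/\ open V, A `<=` V
    & forall theta, solution F theta -> V (theta 0) ->
      forall t, 0 <= t -> U (theta t)].

Definition attractive F A :=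
  exists V, [/\ open V, A `<=` V
    & forall theta, solution F theta -> V (theta 0) ->
      forall U, open U -> A `<=` U -> \forall t \near +oo, U (theta t)].

Definition asymptotically_stable F A := lyapunov_stable F A /\ attractive F A.

Definition equilibrium F (p : torus R m) := forall k, F p k = 0.

Definition asymptotically_stable_equilibrium F (p : torus R m) :=
  equilibrium F p /\ asymptotically_stable F [set p].

End dynamics.

(* Quotient by the phase shifts, in the coordinates psi_k = theta_k - theta_0;
   the section psi |-> (0, psi) represents each orbit. *)
Section phase_differences.
Variables (R : realType) (n : nat).
Implicit Type F : torus R n.+1 -> 'I_n.+1 -> R.

Definition phase_diff (theta : torus R n.+1) : torus R n :=
  fun k => theta (lift ord0 k) - theta ord0.

Definition phase_section (psi : torus R n) : torus R n.+1 :=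
  fun i => if unlift ord0 i is Some k then psi k else 0.

Definition quotient_field F (psi : torus R n) (k : 'I_n) : R :=
  F (phase_section psi) (lift ord0 k) - F (phase_section psi) ord0.

Definition relative_equilibrium F (Omega : R) (theta0 : torus R n.+1) :=
  solution F (fun t k => to_circle (Omega * t) + theta0 k).

Definition stable_relative_equilibrium F Omega theta0 :=
  relative_equilibrium F Omega theta0 /\
  asymptotically_stable_equilibrium (quotient_field F) (phase_diff theta0).

End phase_differences.

Section network.
Variables (R : realType) (N : nat).
Implicit Types (g : circle R -> R) (H : rel 'I_N) (theta : torus R N).

Definition network (omega : R) g theta (k : 'I_N) : R :=
  omega + \sum_(j < N | j != k) g (theta j - theta k).

Definition effective_graph g theta : rel 'I_N :=
  fun j k => (j != k) && `[< ~ DZ g (theta j - theta k) >].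

Definition Theta g H : set (torus R N) := [set theta | effective_graph g theta =2 H].

(* With neighbourhoods of B itself, every forward-invariant open B would be
   asymptotically stable. The usual definition through the distance to B uses
   the sets {dist(., B) < eps}; the torus being compact, these form a
   neighbourhood base of the closure of B, and stability is that of the
   closure. *)
Definition stably_realises omega g H :=
  exists B : set (torus R N),
    [/\ B !=set0, open B, forward_invariant (network omega g) B,
        asymptotically_stable (network omega g) (closure B) & B `<=` Theta g H].

End network.

(* Main.v *)
Require Import Defs.
From mathcomp Require Import all_boot all_order all_algebra.
From mathcomp Require Import all_classical all_reals all_analysis.
From mathcomp Require Import zify ring lra.

Set Implicit Arguments.
Unset Strict Implicit.
Unset Printing Implicit Defensive.
Import Order.TTheory GRing.Theory Num.Theory.
Import numFieldNormedType.Exports.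

Local Open Scope classical_set_scope.
Local Open Scope ring_scope.

(** The phases are locked at points [theta_k] whose pairwise differences
    [theta_j - theta_k], j <> k, are distinct and uniformly separated modulo
    2 pi; multiples of powers of two will do ([offset_sep]). The coupling
    function is then free to be chosen independently near each difference: it
    is a sum of odd smooth profiles, one on a short arc around [theta_j -
    theta_k] for each edge (j, k) of H, and it vanishes everywhere else. Near
    the locked state its effective graph is therefore H, and since every
    profile vanishes at its centre, all oscillators rotate with frequency
    [omega] there ([network_locked]).

    Only the slopes of the profiles at their centres decide stability. Choose
    a spanning diverging tree with root r and parent map, and give the profile
    slope 1 on the tree edges and a small slope on the other edges of H. Up to
    a relative error as small as we please, the deviations z_k of the phases
    from the locked state, measured relative to the root, obey the cascade
      z_k' = z_(parent k) - z_k,  z_r = 0.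
    For a weighted sum of squares whose weights decrease fast enough along the
    tree, the term - z_k in each equation dominates the input from the parent,
    and a margin remains to absorb the errors of the other edges and of the
    nonlinearity ([energy_decay]). So this energy decays exponentially along
    every solution that starts in a sublevel set inside the region where the
    linearisation is valid ([level_decay], from the scalar [exp_decay]).

    Sublevel sets of the energy, projected to the torus of phases or to the
    torus of phase differences, are open because the projection is open
    ([nbhs_to_torus]). In phase differences they form a neighbourhood base of
    the locked state, which gives its asymptotic stability. On the torus of
    phases such a set serves as the basin B. Neighbourhoods of its closure need
    not be invariant under phase shifts, but the orbits of phase shifts are
    compact, so each neighbourhood contains a larger sublevel set
    ([basin_tube]).

    The profile is built from the flat functions exp(-1/s) / s^k, composed with
    cos x - cos delta so that periodicity is automatic. Products and sums of
    these with sines and cosines form a class closed under differentiation,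
    whence smoothness ([trig_flat_smooth]). The profile is not constant on any
    open set meeting its arc ([wave_not_locally_cst]), so locally constant
    points are dead ([LC_DZ]); and the dead zone has finitely many components
    because a component is determined by the set of arcs that lie to its left
    ([finite_components]). *)

(** * The covers of the circle and of the torus *)

Section circle_facts.
Variable R : realType.
Implicit Types (x y : R) (c : circle R).

Lemma to_circleB x y : to_circle (x - y) = to_circle x - to_circle y.
Proof. exact: raddfB. Qed.

Lemma to_circleD x y : to_circle (x + y) = to_circle x + to_circle y.
Proof. exact: raddfD. Qed.

Lemma to_circle_eqP x y :
  to_circle x = to_circle y <-> exists m : int, x = y + m%:~R * (2 * pi).
Proof.
split=> [/eqP|].
  rewrite /to_circle -Quotient.idealrBE => /asboolP[m xy].
  by exists m; rewrite -xy addrC subrK.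
move=> [m ->]; apply/eqP; rewrite /to_circle -Quotient.idealrBE.
by apply/asboolP; exists m; rewrite addrC addrA addNr add0r.
Qed.

Lemma to_circle_repr c : to_circle (repr c) = c.
Proof. exact: reprK. Qed.

Lemma circle_lift c : exists2 x, to_circle x = c & `|x| <= pi.
Proof.
have pi0 := pi_gt0 R.
pose x := repr c; pose m := Num.floor ((x + pi) / (2 * pi)).
exists (x - m%:~R * (2 * pi)).
  rewrite -[RHS]to_circle_repr -/x; apply/to_circle_eqP.
  by exists (- m); rewrite mulrNz mulNr.
have /andP[le_m gt_m] := floor_itv ((x + pi) / (2 * pi)).
move: le_m gt_m; rewrite -/m ler_pdivlMr ?ltr_pdivrMr ?mulr_gt0// intrD.
by move=> le_m gt_m; rewrite ler_norml; apply/andP; split; lra.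
Qed.

Lemma to_circle_continuous : continuous (@to_circle R).
Proof. by apply/continuousP => U; rewrite /open/=. Qed.

(** The covering map is continuous and open: the preimage of the image of an
    open set is the union of its translates by multiples of 2 pi. *)
Lemma nbhs_to_circle x (P : set (circle R)) :
  nbhs (to_circle x) P <-> nbhs x (@to_circle R @^-1` P).
Proof.
split; first exact: to_circle_continuous.
rewrite nbhsE => -[W [oW Wx] WP].
have oV : open (\bigcup_(m : int) [set y : R | W (y - m%:~R * (2 * pi))]).
  apply: bigcup_open => m _.
  apply: (@open_comp _ _ (fun y : R => y - m%:~R * (2 * pi))) => // y _.
  by apply: cvgB; [exact: cvg_id|exact: cvg_cst].
rewrite nbhsE; exists (@to_circle R @` W).
  2: by move=> _ [y Wy <-]; exact: WP.
split; last by exists x.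
suff preE : @to_circle R @^-1` (@to_circle R @` W) =
    \bigcup_(m : int) [set y : R | W (y - m%:~R * (2 * pi))].
  by rewrite /open/= /circle_open preE.
apply/seteqP; split => y /=.
  move=> [z Wz /esym /to_circle_eqP[m yE]].
  by exists m => //=; rewrite yE addrK.
move=> [m _ /= Wy]; exists (y - m%:~R * (2 * pi)) => //.
by apply/to_circle_eqP; exists (- m); rewrite mulrNz mulNr.
Qed.

End circle_facts.

Section torus_cover.
Variables (R : realType) (m : nat).
Implicit Types (x y : 'rV[R]_m) (theta : torus R m).

(** Row vectors rather than functions, so as to have the norm, the balls and the
    compactness of closed bounded sets at hand. *)
Definition to_torus x : torus R m := fun k => to_circle (x 0 k).

Lemma to_torus_surj theta : exists x, to_torus x = theta.
Proof.
exists (\row_k repr (theta k)); apply/funext => k.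
by rewrite /to_torus mxE to_circle_repr.
Qed.

Lemma to_torus_continuous : continuous to_torus.
Proof.
move=> x; apply/cvg_sup; first exact/fmap_filter/(nbhs_filter x).
move=> k U [V [[W oW <-] Wx] VU].
suff : nbhs x (to_torus @^-1` ((fun f => f k) @^-1` W)).
  by apply: filterS => y; exact: VU.
apply: (continuous_comp (@coord_continuous _ _ _ 0 k x)
  (@to_circle_continuous R _)).
exact: open_nbhs_nbhs.
Qed.

(** A ball is a product of intervals, and the image of a product is the product
    of the images, which are neighbourhoods in the finitely many factors. *)
Lemma nbhs_to_torus x (X : set 'rV[R]_m) :
  nbhs x X -> nbhs (to_torus x) (to_torus @` X).
Proof.
move=> /nbhs_ballP[e /= e0 eX].
have cb k : nbhs (to_torus x k) (@to_circle R @` ball (x 0 k) e).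
  apply/nbhs_to_circle; apply: filterS (nbhsx_ballx (x 0 k) e e0) => y ye.
  by exists y.
have : \forall theta \near to_torus x, forall k,
    (@to_circle R @` ball (x 0 k) e) (theta k).
  apply: (@filter_forall _ _ _ _ (nbhs_filter (to_torus x))) => k.
  exact: (@proj_continuous _ (fun=> circle R) k (to_torus x) _ (cb k)).
apply: (@filterS _ _ (nbhs_filter (to_torus x))) => theta inball.
have /choice[yy yP] : forall k, exists y : R, ball (x 0 k) e y /\
    to_circle y = theta k.
  by move=> k; have [y ye yt] := inball k; exists y.
exists (\row_k yy k); last by apply/funext => k; rewrite /to_torus mxE (yP k).2.
by apply: eX; split => // i k; rewrite mxE !ord1; exact: (yP k).1.
Qed.

Lemma to_torus_open (X : set 'rV[R]_m) : open X -> open (to_torus @` X).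
Proof.
move=> oX; rewrite openE => _ [x Xx <-].
by apply: nbhs_to_torus; exact: open_nbhs_nbhs.
Qed.

(** Two lifts of the same point differ by a deck transformation, and this moves
    any third lift within its fibre. *)
Lemma to_torus_eq_shift x x' y :
  to_torus x = to_torus x' -> to_torus (x - x' + y) = to_torus y.
Proof.
move=> xx'; apply/funext => k; rewrite /to_torus !mxE to_circleD to_circleB.
by move/(congr1 (@^~ k)): xx'; rewrite /to_torus => ->; rewrite subrr add0r.
Qed.

End torus_cover.

(** * Flat functions and the wave profile *)

Section flat.
Variable R : realType.
Implicit Types (f g : R -> R) (s x : R).

Lemma is_derive_near_cst f x : (\forall y \near x, f y = f x) ->
  is_derive x 1 f 0.
Proof.
move=> fx; apply: (near_eq_is_derive (f := cst (f x))).
by apply: filterS fx => y /= ->.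
Qed.

(** The powers of 1/s are carried along because differentiating exp(-1/s)
    produces them; the family indexed by k is closed under differentiation
    up to linear combinations. *)
Definition flat (k : nat) s : R :=
  if 0 < s then expR (- s^-1) * s^-1 ^+ k else 0.

Lemma flat_npos k s : s <= 0 -> flat k s = 0.
Proof. by rewrite /flat ltNge => ->. Qed.

Lemma flat_gt0 k s : 0 < s -> 0 < flat k s.
Proof.
by move=> s0; rewrite /flat s0 mulr_gt0 ?expR_gt0// exprn_gt0// invr_gt0.
Qed.

(** The exponential series gives exp t >= t^(k+2) / (k+2)!, used at t = 1/s.
    The quadratic bound is what makes the derivative at 0 vanish. *)
Lemma flat_le k s : `|flat k s| <= k.+2`!%:R * s ^+ 2.
Proof.
have [s0|s0] := leP s 0.
  by rewrite flat_npos// normr0 mulr_ge0 ?ler0n ?sqr_ge0.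
rewrite gtr0_norm ?flat_gt0// /flat s0 expRN.
have t0 : 0 < s^-1 by rewrite invr_gt0.
rewrite -(ler_pM2l (expR_gt0 s^-1)) mulrA mulfV ?gt_eqF ?expR_gt0// mul1r.
have C0 : 0 <= k.+2`!%:R * s ^+ 2 by rewrite mulr_ge0 ?ler0n ?sqr_ge0.
apply: le_trans (ler_wpM2r C0 (expR_ge1Dxn k.+1 (ltW t0))).
rewrite mulrDl mul1r.
rewrite (_ : _ / _ * _ = s^-1 ^+ k).
  by rewrite lerDr mulr_ge0 ?ler0n ?sqr_ge0.
rewrite mulrA divfK ?pnatr_eq0 -?lt0n ?fact_gt0// -addn2 exprD -mulrA.
by rewrite -exprMn mulVf ?gt_eqF// expr1n mulr1.
Qed.

(** At s = 0 both sides vanish: the difference quotient is O(s) by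
    [flat_le]. *)
Lemma is_derive_flat k s :
  is_derive s 1 (flat k) (flat k.+2 s - k%:R * flat k.+1 s).
Proof.
have [s0|s0|->] := ltgtP s 0.
- rewrite !flat_npos ?(ltW s0)// mulr0 subr0; apply: is_derive_near_cst.
  near=> y; rewrite !flat_npos ?(ltW s0)//.
  by apply/ltW; near: y; exact: lt_nbhsl.
- apply: (near_eq_is_derive (f := fun y : R => expR (- y^-1) * y^-1 ^+ k)).
    near=> y; rewrite /flat ifT//.
    by near: y; exact: lt_nbhsr.
  rewrite /flat s0.
  have sn0 : s != 0 by rewrite gt_eqF.
  have dV : is_derive s 1 (fun y : R => y^-1) (- s^-1 ^+ 2).
    apply: is_derive_eq; first exact: (is_deriveV (f := id) sn0).
    by rewrite /GRing.scale/= mulr1 exprVn.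
  have dE := @is_derive1_comp _ expR (fun y => - y^-1) s _ _
    (is_derive_expR (- s^-1)) (is_deriveN dV).
  have dX : is_derive s 1 (fun y : R => y^-1 ^+ k)
      (k%:R * s^-1 ^+ k.-1 * - s^-1 ^+ 2).
    rewrite (_ : (fun y : R => _) = (GRing.inv : R -> R) ^+ k); last first.
      by apply/funext => y; rewrite fctE.
    exact: is_deriveX.
  apply: is_derive_eq.
  rewrite /GRing.scale/= opprK.
  case: k dX => [|k] dX; rewrite ?mul0r ?mulr0 ?add0r ?subr0 ?expr0; first ring.
  rewrite !exprS/=; ring.
- rewrite !flat_npos// mulr0 subr0.
  have cvg0 : h^-1 *: (flat k (h *: 1 + 0) - flat k 0)
      @[h --> (0 : R)^'] --> (0 : R).
    apply/cvgr0Pnorm_lt => e e0.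
    have C0 : 0 < k.+2`!%:R :> R by rewrite ltr0n fact_gt0.
    near=> h.
    have h0 : h != 0 by near: h; exact: nbhs_dnbhs_neq.
    rewrite [h *: 1]mulr1 addr0 (flat_npos _ (lexx _)) subr0 normrM normfV.
    rewrite mulrC ltr_pdivrMr ?normr_gt0//.
    apply: (le_lt_trans (flat_le k h)).
    rewrite -real_normK ?num_real// expr2 mulrA ltr_pM2r ?normr_gt0//.
    rewrite -ltr_pdivlMl//.
    near: h; apply: nbhs_dnbhs; apply/nbhs_ballP.
    exists (k.+2`!%:R^-1 * e) => /=; first by rewrite mulr_gt0 ?invr_gt0.
    by move=> y; rewrite /ball/= sub0r normrN.
  by apply: DeriveDef; [apply/cvg_ex; exists 0|exact: cvg_lim].
Unshelve. all: by end_near. Qed.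

(** A class of functions closed under differentiation, hence made of smooth
    functions; it is large enough to contain the profiles below. *)
Inductive trig_flat : (R -> R) -> Prop :=
| trig_flat_cst c : trig_flat (fun=> c)
| trig_flat_sin d : trig_flat (fun x => sin (x - d))
| trig_flat_cos d : trig_flat (fun x => cos (x - d))
| trig_flat_flat k a d : trig_flat (fun x => flat k (cos (x - d) - a))
| trig_flatD f g : trig_flat f -> trig_flat g ->
    trig_flat (fun x => f x + g x)
| trig_flatM f g : trig_flat f -> trig_flat g ->
    trig_flat (fun x => f x * g x).

Lemma is_derive_sub d x : is_derive x 1 (fun y => y - d) 1.
Proof.
by apply: is_derive_eq; rewrite subr0.
Qed.

Lemma is_derive_sin_sub d x :
  is_derive x 1 (fun y => sin (y - d)) (cos (x - d)).
Proof.
have := @is_derive1_comp _ sin (fun y => y - d) x _ _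
  (is_derive_sin (x - d)) (is_derive_sub d x).
by rewrite mulr1.
Qed.

Lemma is_derive_cos_sub d x :
  is_derive x 1 (fun y => cos (y - d)) (- sin (x - d)).
Proof.
have := @is_derive1_comp _ cos (fun y => y - d) x _ _
  (is_derive_cos (x - d)) (is_derive_sub d x).
by rewrite mulr1.
Qed.

Lemma is_derive_flat_cos k a d x :
  is_derive x 1 (fun y => flat k (cos (y - d) - a))
    ((flat k.+2 (cos (x - d) - a) - k%:R * flat k.+1 (cos (x - d) - a)) *
     - sin (x - d)).
Proof.
have dc : is_derive x 1 (fun y => cos (y - d) - a) (- sin (x - d)).
  have dc := is_derive_cos_sub d x.
  by apply: is_derive_eq; rewrite subr0.
exact: (@is_derive1_comp _ (flat k) (fun y => cos (y - d) - a) x _ _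
  (is_derive_flat k (cos (x - d) - a)) dc).
Qed.

Lemma trig_flat_derive f : trig_flat f ->
  exists2 f', trig_flat f' & forall x, is_derive x 1 f (f' x).
Proof.
elim=> [c|d|d|k a d|{}f g _ [f' tf' df] _ [g' tg' dg]|
  {}f g tf [f' tf' df] tg [g' tg' dg]].
- by exists (fun=> 0); [exact: trig_flat_cst|move=> x; exact: is_derive_cst].
- by exists (fun x => cos (x - d)); [exact: trig_flat_cos|
    exact: is_derive_sin_sub].
- exists (fun x => -1 * sin (x - d)).
    by apply: trig_flatM; [exact: trig_flat_cst|exact: trig_flat_sin].
  by move=> x; rewrite mulN1r; exact: is_derive_cos_sub.
- exists (fun x => (flat k.+2 (cos (x - d) - a) +
     - k%:R * flat k.+1 (cos (x - d) - a)) * (-1 * sin (x - d))).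
    by do ![exact: trig_flat_flat|exact: trig_flat_cst|exact: trig_flat_sin|
      apply: trig_flatM|apply: trig_flatD].
  by move=> x; rewrite mulN1r mulNr; exact: is_derive_flat_cos.
- exists (fun x => f' x + g' x); first exact: trig_flatD.
  by move=> x; exact: is_deriveD.
- exists (fun x => f x * g' x + g x * f' x).
    by apply: trig_flatD; exact: trig_flatM.
  by move=> x; exact: is_deriveM.
Qed.

Lemma trig_flat_smooth f : trig_flat f ->
  forall n x, derivable (derive1n n f) x 1.
Proof.
move=> tf n x; suff /trig_flat_derive[f' _ df] : trig_flat (derive1n n f).
  exact: ex_derive.
elim: n => [//|n /trig_flat_derive[f' tf' df]].
rewrite derive1nS (_ : (derive1n n f)^`()%classic = f')//.
by apply/funext => y; rewrite derive1E; exact: derive_val.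
Qed.

Lemma trig_flat_sum I (r : seq I) (F : I -> R -> R) :
  (forall i, trig_flat (F i)) -> trig_flat (fun x => \sum_(i <- r) F i x).
Proof.
move=> tF; elim: r => [|i r IHr].
  rewrite (_ : (fun x => _) = fun=> 0); first exact: trig_flat_cst.
  by apply/funext => x; rewrite big_nil.
rewrite (_ : (fun x => _) = fun x => F i x + \sum_(j <- r) F j x).
  exact: trig_flatD.
by apply/funext => x; rewrite big_cons.
Qed.

(** For a = cos delta, an odd function of slope 1 at 0 which is carried by the
    arcs |x| <= delta modulo 2 pi. Composing the flat function with the cosine
    makes it periodic at no cost. *)
Definition wave a x : R := (flat 0 (1 - a))^-1 * (flat 0 (cos x - a) * sin x).

Lemma trig_flat_wave a d : trig_flat (fun x => wave a (x - d)).
Proof.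
apply: trig_flatM; first exact: trig_flat_cst.
by apply: trig_flatM; [exact: trig_flat_flat|exact: trig_flat_sin].
Qed.

Lemma wave0 a : wave a 0 = 0.
Proof. by rewrite /wave sin0 !mulr0. Qed.

Lemma wave_eq0 a x : cos x <= a -> wave a x = 0.
Proof.
by move=> xa; rewrite /wave (@flat_npos _ (cos x - a)) ?subr_le0// mul0r mulr0.
Qed.

Lemma is_derive_wave a x : is_derive x 1 (wave a)
  ((flat 0 (1 - a))^-1 *
   (flat 0 (cos x - a) * cos x - flat 2 (cos x - a) * sin x ^+ 2)).
Proof.
have := is_derive_flat_cos 0 a 0 x; rewrite mul0r subr0 => df.
have ds := is_derive_sin_sub 0 x.
have fE h : (fun y : R => h (y - 0)) = (h : R -> R).
  by apply/funext => y; rewrite subr0.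
rewrite (fE (fun y => flat 0 (cos y - a))) in df.
rewrite (fE sin) in ds.
have dp := is_deriveZ (flat 0 (1 - a))^-1 (is_deriveM df ds).
apply: is_derive_eq.
by rewrite /GRing.scale/= subr0; congr (_ * _); ring.
Qed.

Lemma is_derive_wave0 a : a < 1 -> is_derive (0 : R) 1 (wave a) 1.
Proof.
move=> a1; have [? dw] := is_derive_wave a 0; apply: DeriveDef => //.
rewrite dw.
rewrite sin0 cos0 expr0n mulr0 subr0 mulr1 mulVf// gt_eqF// flat_gt0//.
by rewrite subr_gt0.
Qed.

Lemma periodicz (f : R -> R) T : periodic f T ->
  forall (m : int) x, f (x + m%:~R * T) = f x.
Proof.
move=> fT [m|m] x; first by rewrite -pmulrn mulr_natl (periodicn fT).
rewrite NegzE mulrNz mulNr -pmulrn mulr_natl.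
by rewrite -[LHS](periodicn fT m.+1) subrK.
Qed.

Lemma wave_period a : periodic (wave a) (2 * pi).
Proof. by move=> x; rewrite /wave mulr_natl cosD2pi sinD2pi. Qed.

(** With c = cos x, the equation says that the derivative of [wave a] vanishes
    at x. On c > a > 0 its left-hand side increases strictly and its right-hand
    side decreases, so it has at most one solution. *)
Lemma wave_crit (a c c' : R) : 0 < a -> a < c -> a < c' ->
  (c - a) ^+ 2 * c = 1 - c ^+ 2 -> (c' - a) ^+ 2 * c' = 1 - c' ^+ 2 -> c = c'.
Proof.
move=> a0 ac ac' cE c'E; apply/eqP; rewrite -subr_eq0; apply/eqP.
have : (c - c') * ((c - a) ^+ 2 + c' * (c - a + (c' - a)) + (c + c')) = 0.
  have : (c - a) ^+ 2 * c - (1 - c ^+ 2) -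
         ((c' - a) ^+ 2 * c' - (1 - c' ^+ 2)) = 0 by rewrite cE c'E !subrr.
  by move=> <-; ring.
move/eqP; rewrite mulf_eq0 => /orP[/eqP//|/eqP h].
have : 0 < (c - a) ^+ 2 + c' * (c - a + (c' - a)) + (c + c').
  have ? : 0 <= (c - a) ^+ 2 by exact: sqr_ge0.
  have ? : 0 < c' * (c - a + (c' - a)) by rewrite mulr_gt0//; lra.
  by lra.
by rewrite h ltxx.
Qed.

(** Where the profile is constant its derivative vanishes, so that [wave_crit]
    fixes the value of the cosine; but the cosine is not locally constant. *)
Lemma wave_not_locally_cst_in a x : 0 < a < 1 -> a < cos x ->
  ~ (\forall y \near x, wave a y = wave a x).
Proof.
move=> /andP[a0 a1] ax wx.
have ca : \forall y \near x, a < cos y.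
  exact: (@continuous_cos R x _ (lt_nbhsr ax)).
have crit : \forall y \near x, (cos y - a) ^+ 2 * cos y = 1 - cos y ^+ 2.
  near=> y.
  have ay : a < cos y by near: y.
  have wy : \forall z \near y, wave a z = wave a y.
    have -> : wave a y = wave a x by near: y.
    by near: y; exact: (near_join wx).
  have [_ +] := is_derive_near_cst wy; have [_ ->] := is_derive_wave a y.
  have s0 : 0 < cos y - a by rewrite subr_gt0.
  have p1 := flat_gt0 0 (_ : 0 < 1 - a); rewrite subr_gt0 in p1.
  have p2 := flat_gt0 0 s0.
  move=> /eqP; rewrite mulf_eq0 invr_eq0 gt_eqF ?p1//= => /eqP.
  rewrite -sin2cos2 /flat s0 expr0 mulr1 -mulrA -mulrBr => /eqP.
  rewrite mulf_eq0 gt_eqF ?expR_gt0//= subr_eq0 => /eqP {2}->.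
  by rewrite mulrA -exprMn mulfV ?gt_eqF// expr1n mul1r.
have cosE : \forall y \near x, cos y = cos x.
  near=> y; apply: (wave_crit a0) => //.
  - by near: y.
  - by near: y.
  - exact: nbhs_singleton crit.
have sinE : \forall y \near x, sin y = sin x.
  near=> y; have dy : is_derive y 1 cos 0.
    apply: is_derive_near_cst; have -> : cos y = cos x by near: y.
    by near: y; exact: (near_join cosE).
  have dx : is_derive x 1 cos 0 by exact: is_derive_near_cst.
  have [_ +] := dy; have [_ +] := dx.
  have [_ ->] := is_derive_cos x; have [_ ->] := is_derive_cos y.
  by move=> /eqP; rewrite oppr_eq0 => /eqP -> /eqP; rewrite oppr_eq0 => /eqP ->.
have [_] := is_derive_near_cst sinE; have [_ ->] := is_derive_sin x.
by move=> c0; move: (lt_trans a0 ax); rewrite c0 ltxx.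
Unshelve. all: by end_near. Qed.

(** On the boundary of the support, points of the interior of the support are
    arbitrarily close, since otherwise cos would have a local maximum there
    with value a, strictly between -1 and 1. *)
Lemma wave_not_locally_cst a x : 0 < a < 1 -> a <= cos x ->
  ~ (\forall y \near x, wave a y = wave a x).
Proof.
move=> a01; rewrite le_eqVlt => /orP[/eqP ax|]; last first.
  exact: wave_not_locally_cst_in.
move=> wx; have [e /= e0 ewx] : nbhs_ball x (fun y => \forall z \near y,
    wave a z = wave a x) by apply/nbhs_ballP; exact: (near_join wx).
have cmax y : y \in `]x - e, x + e[ -> cos y <= cos x.
  rewrite in_itv/= => yxe; rewrite leNgt; apply/negP; rewrite -ax => ay.
  have xy : ball x e y by rewrite /ball/= ltr_distlC.
  apply: (wave_not_locally_cst_in a01 ay).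
  have := ewx _ xy; rewrite /= => wy.
  by rewrite (nbhs_singleton wy).
have [_] : is_derive x 1 cos 0.
  apply: derive1_at_max cmax; first by lra.
  - by move=> t _; exact: derivable_cos.
  - by rewrite in_itv/=; apply/andP; split; lra.
have [_ ->] := is_derive_cos x => /eqP; rewrite oppr_eq0 -norm_cos_eq1 -ax.
by case/andP: a01 => a0 a1; rewrite gtr0_norm// lt_eqF.
Qed.

End flat.

(** * Spanning diverging trees and a Lyapunov function *)

(** The vertices reachable from the root are stable under the underlying
    undirected adjacency: a reachable vertex other than the root has a single
    parent, which lies on the path that reaches it. Hence all vertices are
    reachable, and the parent and depth can be read off shortest paths. *)
Lemma diverging_tree_parent (T : finType) (H A : rel T) :
  spanning_diverging_tree H A ->
  exists (r : T) (par : T -> T) (dep : T -> nat),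
    forall k, k != r -> H (par k) k /\ (dep (par k) < dep k)%N.
Proof.
move=> [AH connA [r [root_r in1]]].
have parent k : k != r -> exists2 p, A p k & forall j, A j k -> j = p.
  move=> /in1/eqP/cards1P[p pE].
  have inE' j : A j k = (j == p).
    by have /setP/(_ j) := pE; rewrite !inE.
  by exists p; [rewrite inE'|move=> j; rewrite inE' => /eqP].
have reach k : connect A r k.
  have /connectP[s sP ->] := connA r k.
  elim/last_ind: s sP => [_|s y IHs]; first exact: connect0.
  rewrite rcons_path last_rcons => /andP[sP /orP[Ay|Ay]].
    exact: connect_trans (IHs sP) (connect1 Ay).
  have xr : last r s != r.
    by apply: contraTneq Ay => ->; exact: root_r.
  have [p _ uniqp] := parent _ xr.
  have /connectP[s' + xE] := IHs sP.
  elim/last_ind: s' xE => [/eqP|s' z _]; first by rewrite (negPf xr).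
  rewrite last_rcons => <-; rewrite rcons_path => /andP[s'P As'].
  rewrite (uniqp _ Ay) -(uniqp _ As').
  by apply/connectP; exists s'.
have pathk k : exists m, [exists s : m.-tuple T, path A r s && (last r s == k)].
  have /connectP[s sP kE] := reach k.
  by exists (size s); apply/existsP; exists (in_tuple s); rewrite sP kE eqxx.
pose dep k := ex_minn (pathk k).
have /choice[par parP] k : exists p, k != r -> A p k /\ (dep p < dep k)%N.
  have [->|kr] := eqVneq k r; first by exists r.
  rewrite {2}/dep; case: ex_minnP => m /existsP[s /andP[sP /eqP kE]] _.
  have szs : size s = m := size_tuple s.
  case/lastP: (tval s) sP kE szs => [|s' z] /=.
    by move=> _ rk; rewrite rk eqxx in kr.
  rewrite rcons_path last_rcons size_rcons => /andP[s'P Az] zk <-.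
  exists (last r s') => _; split; first by rewrite -zk.
  rewrite ltnS /dep; case: ex_minnP => d _; apply.
  by apply/existsP; exists (in_tuple s'); rewrite s'P eqxx.
by exists r, par, dep => k kr; have [/AH] := parP k kr.
Qed.

Section lyapunov.
Variables (R : realType) (T : finType) (r : T) (par : T -> T) (dep : T -> nat).
Hypothesis depP : forall k, k != r -> (dep (par k) < dep k)%N.
Implicit Types z err : T -> R.

Let card_gt0 : 0 < #|T|%:R :> R.
Proof. by rewrite ltr0n; apply/card_gt0P; exists r. Qed.

(** The ratio of the weights of a child and its parent: small enough for the
    total input from the parents to cost at most half of the energy. *)
Definition ratio : R := (2 * #|T|%:R)^-1.

Definition weight k : R := ratio ^+ dep k.

Definition min_weight : R := ratio ^+ \max_k dep k.

Definition energy z : R := \sum_k weight k * z k ^+ 2.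

(** The relative size of the perturbations of the cascade that leaves half of
    the decay rate, 24 being what the estimates in [energy_decay] require. *)
Definition tolerance : R := min_weight / (24 * #|T|%:R ^+ 2).

Lemma ratio_gt0 : 0 < ratio.
Proof. by rewrite invr_gt0 mulr_gt0. Qed.

Lemma ratio_le1 : ratio <= 1.
Proof.
rewrite invf_le1 ?mulr_gt0//.
have : 1 <= #|T|%:R :> R by rewrite ler1n -(ltr0n R).
by lra.
Qed.

Lemma weight_gt0 k : 0 < weight k.
Proof. by rewrite exprn_gt0 ?ratio_gt0. Qed.

Lemma weight_le1 k : weight k <= 1.
Proof. by rewrite exprn_ile1 ?ratio_le1// ltW ?ratio_gt0. Qed.

Lemma min_weight_gt0 : 0 < min_weight.
Proof. by rewrite exprn_gt0 ?ratio_gt0. Qed.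

Lemma weight_ge k : min_weight <= weight k.
Proof.
by rewrite ler_wiXn2l ?ratio_le1 ?(ltW ratio_gt0)//; exact: leq_bigmax.
Qed.

Lemma weight_child k : k != r -> weight k <= ratio * weight (par k).
Proof.
by move=> /depP dk; rewrite -exprS ler_wiXn2l ?ratio_le1 ?(ltW ratio_gt0).
Qed.

Lemma tolerance_gt0 : 0 < tolerance.
Proof. by rewrite divr_gt0 ?min_weight_gt0 ?mulr_gt0 ?exprn_gt0. Qed.

Lemma tolerance_le1 : tolerance <= 1.
Proof.
rewrite ler_pdivrMr ?mulr_gt0 ?exprn_gt0// mul1r.
have : 1 <= #|T|%:R ^+ 2 :> R by rewrite exprn_ege1// ler1n -(ltr0n R).
have : min_weight <= 1 by rewrite exprn_ile1 ?ratio_le1 ?(ltW ratio_gt0).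
by lra.
Qed.

Lemma energy_ge0 z : 0 <= energy z.
Proof.
by apply: sumr_ge0 => k _; rewrite mulr_ge0 ?sqr_ge0 ?ltW ?weight_gt0.
Qed.

Lemma energy_term z k : weight k * z k ^+ 2 <= energy z.
Proof.
rewrite /energy (bigD1 k)//= lerDl; apply: sumr_ge0 => i _.
by rewrite mulr_ge0 ?sqr_ge0 ?ltW ?weight_gt0.
Qed.

Lemma sqr_le_energy z k : z k ^+ 2 <= energy z / min_weight.
Proof.
rewrite ler_pdivlMr ?min_weight_gt0// mulrC; apply: le_trans (energy_term z k).
by rewrite ler_wpM2r ?sqr_ge0 ?weight_ge.
Qed.

(** The right-hand side of the tree cascade with perturbation [err], before the
    motion of the root is subtracted. *)
Definition drift z err k : R :=
  (if k == r then 0 else z (par k) - z k) + err k.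

(** In d/dt (w_k z_k^2), the inequality 2 z_k z_p <= z_k^2 + z_p^2 for the
    parent p leaves - w_k z_k^2 + w_k z_p^2. Summed over k, the first terms
    give minus the energy V; each of the second is at most ratio * w_p z_p^2,
    so together they cost at most V / 2. The perturbations cost at most V / 4. *)
Lemma energy_decay z err : z r = 0 ->
  (forall k, `|err k| <= tolerance * \sum_j `|z j - z k|) ->
  \sum_k weight k * (2 * z k * (drift z err k - drift z err r))
    <= - (4^-1 * energy z).
Proof.
move=> zr errP; set V := energy z; set W := V / min_weight.
have V0 : 0 <= V := energy_ge0 z.
have prodW j k : `|z j| * `|z k| <= W.
  have := sqr_le_energy z j; have := sqr_le_energy z k; rewrite -/V -/W.
  rewrite -(real_normK (num_real (z k))) -(real_normK (num_real (z j))).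
  move=> zk zj.
  have := sqr_ge0 (`|z j| - `|z k|); rewrite sqrrB; lra.
pose E := 6 * tolerance * #|T|%:R * W.
have errE k : 2 * `|z k| * (`|err k| + `|err r|) <= E.
  have : `|err k| + `|err r| <=
      tolerance * \sum_(j : T) (2 * `|z j| + `|z k|).
    apply: le_trans (lerD (errP k) (errP r)) _.
    rewrite -mulrDr -big_split/= ler_wpM2l ?(ltW tolerance_gt0)//.
    apply: ler_sum => j _; rewrite zr subr0.
    by have := ler_normB (z j) (z k); lra.
  have zk0 : 0 <= 2 * `|z k| by rewrite mulr_ge0.
  move=> /(ler_wpM2l zk0)/le_trans; apply.
  rewrite mulrA -(mulrC tolerance) -mulrA mulr_sumr.
  have -> : E = tolerance * (#|T|%:R * (6 * W)) by rewrite /E; ring.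
  rewrite ler_wpM2l ?(ltW tolerance_gt0)// [leRHS]mulr_natl -sumr_const.
  apply: ler_sum => j _.
  have -> : 2 * `|z k| * (2 * `|z j| + `|z k|) =
    4 * (`|z j| * `|z k|) + 2 * (`|z k| * `|z k|) by ring.
  by have := prodW j k; have := prodW k k; lra.
have E0 : 0 <= E.
  by apply: le_trans (errE r); rewrite zr normr0 mulr0 mul0r.
have term k : weight k * (2 * z k * (drift z err k - drift z err r)) <=
    - (weight k * z k ^+ 2) + ratio * V + E.
  have [->|kr] := eqVneq k r.
    rewrite zr expr0n/= !(mulr0, mul0r, oppr0, add0r) addr_ge0//.
    by rewrite mulr_ge0// ltW ?ratio_gt0.
  rewrite /drift (negPf kr) eqxx add0r.
  have errk : weight k * (2 * z k * (err k - err r)) <= E.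
    apply: le_trans (errE k); apply: le_trans (ler_norm _) _.
    rewrite !normrM (gtr0_norm (weight_gt0 k)) normr_nat -mulrA.
    rewrite -[leRHS]mul1r; apply: ler_pM; rewrite ?weight_le1//.
      exact/ltW/weight_gt0.
    by rewrite -mulrA !ler_wpM2l// ler_normB.
  have park : weight k * z (par k) ^+ 2 <= ratio * V.
    apply: le_trans (ler_wpM2r (sqr_ge0 _) (weight_child kr)) _.
    by rewrite -mulrA ler_wpM2l ?(ltW ratio_gt0)// energy_term.
  have sq : weight k * (2 * z k * (z (par k) - z k)) <=
      weight k * (z (par k) ^+ 2 - z k ^+ 2).
    rewrite ler_wpM2l ?(ltW (weight_gt0 k))//.
    by have := sqr_ge0 (z k - z (par k)); rewrite sqrrB; lra.
  have -> : weight k * (2 * z k * (z (par k) - z k + err k - err r)) =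
    weight k * (2 * z k * (z (par k) - z k)) +
    weight k * (2 * z k * (err k - err r)) by ring.
  by move: sq; rewrite mulrBr; lra.
apply: le_trans (ler_sum _ (fun k _ => term k)) _.
rewrite !big_split/= sumrN -/(energy z) -/V !sumr_const.
rewrite -[(ratio * V) *+ _]mulr_natl -[E *+ _]mulr_natl.
have N0 : #|T|%:R != 0 :> R by rewrite gt_eqF.
have -> : #|T|%:R * (ratio * V) = V / 2 by rewrite /ratio; field.
have -> : #|T|%:R * E = V / 4.
  have m0 : min_weight != 0 by rewrite gt_eqF ?min_weight_gt0.
  by rewrite /E /W /tolerance; field; rewrite m0.
lra.
Qed.

End lyapunov.

(** * Coupling functions carried by prescribed arcs *)

Section cosine.
Variable R : realType.
Implicit Types u delta : R.

Lemma cos_le_far delta u : 0 < delta -> delta <= pi ->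
  delta <= `|u| <= 2 * pi - delta -> cos u <= cos delta.
Proof.
move=> d0 dpi /andP[du ud]; rewrite -(cos_norm u).
have mono (x y : R) : 0 <= x -> x <= y -> y <= pi -> cos y <= cos x.
  move=> x0 xy ypi.
  have xI : x \in `[0, pi] by rewrite in_itv/= x0 (le_trans xy).
  have yI : y \in `[0, pi] by rewrite in_itv/= ypi (le_trans x0).
  by rewrite leNgt ltr_cos// -leNgt.
have [upi|upi] := leP `|u| pi; first by apply: mono => //; exact: ltW.
rewrite -[cos `|u|]cosN -[cos (- _)]cosD2pi -mulr_natl.
by apply: mono; rewrite ?(ltW d0)//; lra.
Qed.

Lemma cos_lt_far delta u : 0 < delta -> delta <= pi ->
  delta < `|u| < 2 * pi - delta -> cos u < cos delta.
Proof.
move=> d0 dpi /andP[du ud].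
pose e := Num.min `|u| (2 * pi - `|u|).
have [de epi] : delta < e /\ e <= pi.
  by rewrite /e lt_min ge_min; split; [lra|apply/orP; lra].
have ecos : cos u <= cos e.
  apply: cos_le_far => //; first exact: lt_trans de.
  by rewrite /e ge_min lexx/= lerBrDr -lerBrDl ge_min lexx orbT.
apply: le_lt_trans ecos _; rewrite ltr_cos ?in_itv//=; apply/andP; split; lra.
Qed.

Lemma cos_ge_near delta u : delta <= pi -> `|u| <= delta -> cos delta <= cos u.
Proof.
move=> dpi ud; rewrite -(cos_norm u) leNgt.
have uI : `|u| \in `[0, pi] by rewrite in_itv/= normr_ge0 (le_trans ud).
have dI : delta \in `[0, pi] by rewrite in_itv/= dpi (le_trans _ ud).
by rewrite ltr_cos// -leNgt.
Qed.

Lemma cos_small delta : 0 < delta <= 2^-1 -> 0 < cos delta < 1.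
Proof.
move=> /andP[d0 d1]; have p2 := pi_ge2 R; apply/andP; split.
  by apply: cos_gt0_pihalf; apply/andP; split; lra.
by rewrite -cos0 ltr_cos ?in_itv/=//; apply/andP; split; lra.
Qed.

(** Points close to the centre a of one arc stay off the arc around any other
    centre b. The bounds on a and b prevent b from being close to a modulo
    2 pi. *)
Lemma cos_lt_other delta x a b : 0 < delta <= 2^-1 -> `|a| <= 1 -> `|b| <= 1 ->
  4 * delta <= `|a - b| -> `|x - a| <= 2 * delta -> cos (x - b) < cos delta.
Proof.
move=> /andP[d0 d1] a1 b1 ab xa; have p2 := pi_ge2 R.
have ab1 : `|a - b| <= `|x - b| + `|x - a|.
  rewrite (_ : a - b = (x - b) - (x - a)); last by ring.
  exact: ler_normB.
have ab2 : `|x - b| <= `|x - a| + `|a - b|.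
  rewrite (_ : x - b = (x - a) + (a - b)); last by ring.
  exact: ler_normD.
have ab3 := ler_normB a b.
by apply: cos_lt_far => //; [lra|apply/andP; split; lra].
Qed.

End cosine.

Section coupling.
Variables (R : realType) (I : finType) (P : pred I) (d w : I -> R) (delta : R).
Hypothesis delta_small : 0 < delta <= 2^-1.
Hypothesis d_small : forall i, `|d i| <= 1.
Hypothesis d_sep : forall i j, P i -> P j -> i != j ->
  4 * delta <= `|d i - d j|.
Hypothesis w_neq0 : forall i, P i -> w i != 0.

Definition profile (x : R) : R :=
  \sum_(i | P i) w i * wave (cos delta) (x - d i).

Definition coupling (c : circle R) : R := profile (repr c).

(** Outside all closed arcs, expressed through the cosine to be insensitive to
    the choice of the lift. *)
Definition dead (x : R) := forall i, P i -> cos (x - d i) < cos delta.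

Let cosd01 : 0 < cos delta < 1. Proof. exact: cos_small. Qed.

Lemma profile_period (m : int) x : profile (x + m%:~R * (2 * pi)) = profile x.
Proof.
apply: eq_bigr => i _; congr (_ * _).
by rewrite addrAC (periodicz (@wave_period R _)).
Qed.

Lemma coupling_to_circle x : coupling (to_circle x) = profile x.
Proof.
have /to_circle_eqP[m xE] := to_circle_repr (to_circle x).
by rewrite /coupling xE profile_period.
Qed.

Lemma coupling_smooth : smooth coupling.
Proof.
have -> : smooth coupling = forall n x, derivable (derive1n n profile) x 1.
  rewrite /smooth (_ : coupling \o _ = profile)//.
  by apply/funext => x; exact: coupling_to_circle.
apply: trig_flat_smooth.
rewrite (_ : profile = fun x =>
    \sum_i (if P i then w i else 0) * wave (cos delta) (x - d i)).
  apply: trig_flat_sum => i; apply: trig_flatM; first exact: trig_flat_cst.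
  exact: trig_flat_wave.
apply/funext => x; rewrite /profile big_mkcond/=; apply: eq_bigr => i _.
by case: ifP; rewrite ?mul0r.
Qed.

Lemma profile_eq0 x : (forall i, P i -> cos (x - d i) <= cos delta) ->
  profile x = 0.
Proof.
by move=> xP; rewrite /profile big1// => i /xP/wave_eq0->; rewrite mulr0.
Qed.

Lemma profile_near i x : P i -> `|x - d i| <= 2 * delta ->
  profile x = w i * wave (cos delta) (x - d i).
Proof.
move=> Pi xi; rewrite /profile (bigD1 i)//= big1 ?addr0// => j /andP[Pj ji].
rewrite wave_eq0 ?mulr0//; apply/ltW.
apply: (cos_lt_other delta_small (d_small i)) => //.
by apply: d_sep => //; rewrite eq_sym.
Qed.

(** For lifts in [-pi, pi] the arcs become intervals of the line. *)
Lemma dead_lift x : `|x| <= pi ->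
  dead x <-> forall i, P i -> delta < `|x - d i|.
Proof.
move=> xpi; have p2 := pi_ge2 R; case/andP: delta_small => d0 d1.
split=> xP i /[dup] Pi /xP xi.
  rewrite ltNge; apply: contraTN xi => xi.
  by rewrite -leNgt; apply: cos_ge_near => //; lra.
apply: cos_lt_far => //; first by lra.
rewrite xi/=; have := ler_normB x (d i); have := d_small i; lra.
Qed.

Lemma dead_shift (m : int) x : dead (x + m%:~R * (2 * pi)) <-> dead x.
Proof.
have cosE y : cos (y + m%:~R * (2 * pi)) = cos y.
  by apply: periodicz => z; rewrite mulr_natl cosD2pi.
by split=> xP i /xP; rewrite addrAC cosE.
Qed.

Lemma dead_DZ x : dead x -> DZ coupling (to_circle x).
Proof.
move=> xO; apply/nbhs_to_circle => /=.
have : \forall y \near x, forall i, P i -> cos (y - d i) < cos delta.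
  apply: (@filter_forall _ _ _ _ (nbhs_filter x)) => i.
  case: (boolP (P i)) => Pi; last first.
    exact: nearW.
  have cc : {for x, continuous (fun y : R => cos (y - d i))}.
    apply: continuous_comp; last exact: continuous_cos.
    by apply: cvgB; [exact: cvg_id|exact: cvg_cst].
  by apply: (@filterS _ _ (nbhs_filter x) _ _ _ (cc _ (lt_nbhsl (xO i Pi)))).
apply: filterS => y yO; rewrite /preimage/= coupling_to_circle.
rewrite profile_eq0// => i /yO.
exact: ltW.
Qed.

(** By contraposition: on a closed arc, near the given point, all profiles but
    one vanish, and the remaining one is not locally constant. *)
Lemma LC_dead x : LC coupling (to_circle x) -> dead x.
Proof.
have [y yx ypi] := circle_lift (to_circle x).
have [m ->] : exists m : int, x = y + m%:~R * (2 * pi) by apply/to_circle_eqP.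
rewrite (_ : to_circle _ = to_circle y); last first.
  by apply/to_circle_eqP; exists m.
move=> yLC; apply/dead_shift/(dead_lift ypi) => i Pi.
rewrite ltNge; apply/negP => yi.
case/andP: delta_small => d0 d1; have p2 := pi_ge2 R.
apply: (wave_not_locally_cst cosd01 (x := y - d i)).
  by apply: cos_ge_near => //; lra.
have near_y : \forall z \near y, wave (cos delta) (z - d i) =
    wave (cos delta) (y - d i).
  have {}yLC : \forall z \near y, profile z = profile y.
    move/nbhs_to_circle: yLC; apply: filterS => z /=.
    by rewrite !coupling_to_circle.
  near=> z; apply: (mulfI (w_neq0 Pi)).
  have yz : `|y - z| < delta.
    by near: z; apply/nbhs_ballP; exists delta.
  have zi : `|z - d i| <= 2 * delta.
    have -> : z - d i = (y - d i) - (y - z) by ring.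
    by apply: le_trans (ler_normB _ _) _; lra.
  rewrite -(profile_near Pi zi) -(profile_near Pi); last by lra.
  by near: z.
have sub_cvg : (v + d i) @[v --> y - d i] --> y.
  rewrite -[X in _ --> X](subrK (d i) y).
  by apply: cvgD; [exact: cvg_id|exact: cvg_cst].
apply: (@filterS _ _ (nbhs_filter (y - d i)) _ _ _ (sub_cvg _ near_y)) => v /=.
by rewrite addrK.
Unshelve. all: by end_near. Qed.

Lemma DZ_LC c : DZ coupling c -> LC coupling c.
Proof. by move=> cD; have c0 := nbhs_singleton cD; rewrite /LC/= c0. Qed.

Lemma DZ_dead x : DZ coupling (to_circle x) <-> dead x.
Proof. by split; [move=> /DZ_LC/LC_dead|exact: dead_DZ]. Qed.

Lemma LC_DZ : LC coupling = DZ coupling.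
Proof.
apply/seteqP; split => c; last exact: DZ_LC.
by rewrite -(to_circle_repr c) => /LC_dead/dead_DZ.
Qed.

(** If no arc separates x from y, then the whole segment from x to y is dead. *)
Lemma connected_dead x y : `|x| <= pi -> `|y| <= pi -> dead x -> dead y ->
  x <= y -> (forall i, P i -> (d i < x) = (d i < y)) ->
  connected_component (DZ coupling) (to_circle x) (to_circle y).
Proof.
move=> xpi ypi xO yO xy dE.
have /(dead_lift xpi) xfar := xO; have /(dead_lift ypi) yfar := yO.
exists (to_circle (R:=R) @` `[x, y]); last first.
  by exists y => //=; rewrite in_itv/= xy lexx.
split.
- by exists x => //=; rewrite in_itv/= xy lexx.
- move=> _ [z + <-]; rewrite /= in_itv/= => /andP[xz zy]; apply: dead_DZ.
  have zpi : `|z| <= pi by move: xpi ypi; rewrite !ler_norml; lra.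
  apply/(dead_lift zpi) => i Pi.
  case/andP: delta_small => d0 d1.
  have := xfar i Pi; have := yfar i Pi; have := dE i Pi.
  rewrite !real_ltr_normr ?num_real//.
  have [dx /esym dy _ /orP[]|dx /esym/negbT dy /orP[]] := boolP (d i < x);
    [lra|lra| |].
    by rewrite -leNgt in dy; lra.
  by rewrite -!leNgt in dx dy => ? _; apply/orP; right; lra.
- apply: connected_continuous_connected; first exact: segment_connected.
  by apply: continuous_subspaceT; exact: to_circle_continuous.
Qed.

(** Cutting the circle at pi, a component is determined by the set of arcs to
    the left of one of its points; there are finitely many such sets. *)
Lemma finite_components :
  finite_set [set connected_component (DZ coupling) c | c in DZ coupling].
Proof.
have /choice[L LP] : forall c : circle R,
    exists x : R, to_circle x = c /\ `|x| <= pi.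
  by move=> c; have [x xc xpi] := circle_lift c; exists x.
have {LP}[LK Lpi] := all_and2 LP.
pose key c := [set i | d i < L c]%SET.
have sameP c c' : DZ coupling c -> DZ coupling c' -> key c = key c' ->
    connected_component (DZ coupling) c = connected_component (DZ coupling) c'.
  move=> cD c'D cc'.
  have dE i : (d i < L c) = (d i < L c').
    by have /setP/(_ i) := cc'; rewrite !inE.
  have cO : dead (L c) by apply/DZ_dead; rewrite LK.
  have c'O : dead (L c') by apply/DZ_dead; rewrite LK.
  apply: same_connected_component; rewrite -(LK c) -(LK c').
  have [cc|/ltW cc] := leP (L c) (L c'); first exact: connected_dead.
  by apply: connected_component_sym; exact: connected_dead.
pose rep K := xget 0 [set c | DZ coupling c /\ key c = K].
apply: (@sub_finite_set _ _
  ((fun K => connected_component (DZ coupling) (rep K)) @` [set: {set I}])).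
  move=> _ [c cD <-]; exists (key c) => //.
  have [repD repK] : DZ coupling (rep (key c)) /\ key (rep (key c)) = key c.
    by rewrite /rep; case: xgetP => [y _ //|/(_ c)[]].
  exact: sameP.
exact/finite_image/finite_finset.
Qed.

Lemma coupling_is_coupling_function i : P i -> coupling_function coupling.
Proof.
move=> Pi; split; first exact: coupling_smooth.
  move=> [c gc]; have : LC coupling (to_circle (d i)).
    apply/nbhs_to_circle; apply: (@filterS _ _ (nbhs_filter (d i)) setT) => //.
      by move=> y _; rewrite /preimage/= !gc.
    exact: filterT.
  by move=> /LC_dead /(_ i Pi); rewrite subrr cos0 ltNge cos_le1.
by split; [exact: finite_components|exact: LC_DZ].
Qed.

End coupling.


(** * Phases with well separated differences *)

Section phases.
Variables (R : realType) (n : nat).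

(** The unit in which the phases are powers of two; all phases are then at most
    1, and differences of phases cannot coincide modulo 2 pi unless they are
    equal. *)
Definition gap : R := 2^-1 ^+ n.

Definition phase (k : 'I_n) : R := gap * 2 ^+ k.

Definition offset (e : 'I_n * 'I_n) : R := phase e.1 - phase e.2.

Lemma gap_gt0 : 0 < gap.
Proof. by rewrite exprn_gt0. Qed.

Lemma phase_bound k : 0 < phase k <= 1.
Proof.
rewrite mulr_gt0 ?gap_gt0 ?exprn_gt0//= /phase /gap exprVn mulrC.
rewrite ler_pdivrMr ?exprn_gt0// mul1r ler_weXn2l ?ler1n//.
exact/ltnW/ltn_ord.
Qed.

Lemma offset_small e : `|offset e| <= 1.
Proof.
have /andP[h1 h2] := phase_bound e.1; have /andP[h3 h4] := phase_bound e.2.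
by rewrite /offset ler_norml; apply/andP; split; lra.
Qed.

(** The larger exponent is determined: 2^a - 2^b lies in [2^(a-1), 2^a). The
    equation is written without subtraction. *)
Lemma pow2_sub_inj (a b c e : nat) : (b < a)%N -> (e < c)%N ->
  (2 ^ a + 2 ^ e = 2 ^ c + 2 ^ b)%N -> a = c /\ b = e.
Proof.
have aux x y z t : (y < x)%N -> (t < z)%N -> (x < z)%N ->
    (2 ^ x + 2 ^ t = 2 ^ z + 2 ^ y)%N -> False.
  move=> yx tz xz.
  have : (2 ^ x.+1 <= 2 ^ z)%N by rewrite leq_exp2l.
  have : (2 ^ t.+1 <= 2 ^ z)%N by rewrite leq_exp2l.
  have : (0 < 2 ^ y)%N by rewrite expn_gt0.
  rewrite !expnS; lia.
move=> ba ec eq_pow; case: (ltngtP a c) => [ac|ca|ac].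
- by case: (aux _ _ _ _ ba ec ac).
- by case: (aux _ _ _ _ ec ba ca).
- split=> //; move: eq_pow; rewrite ac => /addnI /eqP.
  by rewrite eqn_exp2l// => /eqP.
Qed.

Lemma pow2_offset_inj (j k l m : nat) : j != k -> l != m ->
  (2 ^ j + 2 ^ m = 2 ^ l + 2 ^ k)%N -> j = l /\ k = m.
Proof.
move=> jk lm eq_pow.
have pow_lt a b : (a < b)%N -> (2 ^ a < 2 ^ b)%N by rewrite ltn_exp2l.
case: (ltngtP k j) jk => // kj _; case: (ltngtP m l) lm => // ml _.
- exact: pow2_sub_inj.
- by have := pow_lt _ _ kj; have := pow_lt _ _ ml; lia.
- by have := pow_lt _ _ kj; have := pow_lt _ _ ml; lia.
- by have [] := @pow2_sub_inj k j m l kj ml _; first lia.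
Qed.

(** In units of [gap] the offsets are distinct integers. *)
Lemma offset_sep e e' : e.1 != e.2 -> e'.1 != e'.2 -> e != e' ->
  gap <= `|offset e - offset e'|.
Proof.
move=> e12 e'12 ee'; pose a := (2 ^ e.1 + 2 ^ e'.2)%N.
pose b := (2 ^ e'.1 + 2 ^ e.2)%N.
have ab : a != b.
  apply: contra ee' => /eqP/(pow2_offset_inj e12 e'12)[e1E e2E].
  by rewrite -pair_eqE/= -!val_eqE/= e1E e2E !eqxx.
have -> : offset e - offset e' = gap * (a%:R - b%:R).
  by rewrite /offset /phase /a /b !natrD !natrX; ring.
rewrite normrM gtr0_norm ?gap_gt0// -[leLHS]mulr1 ler_wpM2l ?(ltW gap_gt0)//.
rewrite -[a%:R]/(a%:Z%:~R) -[b%:R]/(b%:Z%:~R) -intrB -intr_norm.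
rewrite -[1]/(1%:~R) ler_int -gtz0_ge1 normr_gt0 subr_eq0.
by rewrite eqz_nat.
Qed.

End phases.

(** * Scalar estimates *)

Section scalar_estimates.
Variable R : realType.

Lemma linear_approx (f : R -> R) (eps : R) : f 0 = 0 ->
  is_derive (0 : R) 1 f 1 -> 0 < eps ->
  exists2 e : R, 0 < e & forall u, `|u| < e -> `|f u - u| <= eps * `|u|.
Proof.
move=> f0 [fd fv] eps0.
have : h^-1 *: ((f \o shift 0) (h *: 1) - f 0) @[h --> 0^'] --> (1 : R).
  by rewrite -[X in _ --> X]fv; exact: fd.
move=> /cvgrPdist_le /(_ _ eps0).
rewrite near_withinE => /nbhs_ballP[e /= e0 eP]; exists e => // u ue.
have [->|u0] := eqVneq u 0; first by rewrite f0 subrr normr0 mulr0.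
have := eP u; rewrite /ball/= sub0r normrN => /(_ ue u0).
rewrite f0 subr0 addr0 /GRing.scale/= mulr1 => h.
rewrite -[leLHS]normrN (_ : - _ = u * (1 - u^-1 * f u)).
  by rewrite normrM mulrC ler_wpM2r.
by rewrite mulrBr mulrA mulfV// mul1r mulr1 opprB.
Qed.

(** The bound on the derivative holds only below rho, but f cannot reach rho: at
    the first time when it would, f has been decreasing from a value below rho.
    Then exp(lambda t) f t is nonincreasing. *)
Lemma exp_decay (f df : R -> R) (rho lambda : R) : 0 < lambda ->
  (forall t : R, is_derive t 1 f (df t)) -> (forall t, 0 <= f t) -> f 0 < rho ->
  (forall t, f t < rho -> df t <= - (lambda * f t)) ->
  forall t, 0 <= t -> f t <= expR (- (lambda * t)) * f 0.
Proof.
move=> l0 fd f0 f0rho dfP.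
have fdrv t : derivable f t 1 by case: (fd t).
have fcont : continuous f.
  by move=> t; apply/differentiable_continuous/derivable1_diffP.
have df1 t : f^`()%classic t = df t by rewrite derive1E; exact: derive_val.
have below t : 0 <= t -> f t < rho.
  move=> t0; rewrite ltNge; apply/negP => rhoft.
  pose E := [set s | 0 <= s <= t /\ rho <= f s].
  have Et : E t by split => //; rewrite t0 lexx.
  have E_lb : has_lbound E by exists 0 => s [/andP[]].
  have hinfE : has_inf E by split => //; exists t.
  have i0 : 0 <= inf E by apply: lb_le_inf; [exists t|move=> s [/andP[]]].
  have it : inf E <= t by exact: ge_inf.
  have rhoi : rho <= f (inf E).
    rewrite leNgt; apply/negP => fi.
    have /nbhs_ballP[e /= e0 eP] := fcont _ _ (lt_nbhsl fi).
    have [s Es si] := inf_adherent e0 hinfE.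
    have is_ : inf E <= s by exact: ge_inf.
    have fs : f s < rho.
      by apply: eP; rewrite /ball/= distrC ger0_norm ?subr_ge0// ltrBlDl.
    by case: Es => _; rewrite leNgt fs.
  have lt_i s : 0 <= s < inf E -> f s < rho.
    move=> /andP[s0 si]; rewrite ltNge; apply/negP => rhos.
    have : inf E <= s.
      by apply: ge_inf => //; split => //; rewrite s0 (le_trans (ltW si)).
    by rewrite leNgt si.
  have : f (inf E) <= f 0.
    apply: (@ler0_derive1_le_cc R f 0 (inf E)) => //.
    - move=> s; rewrite in_itv/= => /andP[s0 si]; rewrite df1.
      have si' : f s < rho by apply: lt_i; rewrite (ltW s0) si.
      apply: le_trans (dfP s si') _.
      by rewrite oppr_le0 mulr_ge0// ltW.
    - exact: continuous_subspaceT.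
    - by rewrite in_itv/= lexx i0.
    - by rewrite in_itv/= lexx i0.
  by move=> fi; have := le_lt_trans (le_trans rhoi fi) f0rho; rewrite ltxx.
move=> t t0.
pose g s := expR (lambda * s) * f s.
have gd (s : R) : is_derive s 1 g (expR (lambda * s) * df s +
    f s * (lambda * expR (lambda * s))).
  have dl : is_derive s 1 (fun y : R => lambda * y) lambda.
    have := is_deriveZ lambda (is_derive_id s 1).
    by rewrite /GRing.scale/= mulr1.
  have dE := @is_derive1_comp _ expR (fun y => lambda * y) s _ _
    (is_derive_expR (lambda * s)) dl.
  have := is_deriveM dE (fd s).
  by rewrite /GRing.scale/= [lambda * expR _]mulrC.
have gdrv (s : R) : derivable g s 1 by case: (gd s).
have : g t <= g 0.
  apply: (@ler0_derive1_le_cc R g 0 t) => //.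
  - move=> s; rewrite in_itv/= => /andP[s0 st].
    rewrite derive1E derive_val.
    rewrite [X in _ + X](_ : _ = expR (lambda * s) * (lambda * f s)).
      2: by ring.
    rewrite -mulrDr pmulr_rle0 ?expR_gt0//.
    by have := dfP s (below s (ltW s0)); lra.
  - apply: continuous_subspaceT => s.
    by apply/differentiable_continuous/derivable1_diffP.
  - by rewrite in_itv/= lexx t0.
  - by rewrite in_itv/= lexx t0.
rewrite /g mulr0 expR0 mul1r => gt; rewrite expRN.
rewrite -(ler_pM2l (expR_gt0 (lambda * t))) mulrA mulfV ?mul1r//.
by rewrite gt_eqF ?expR_gt0.
Qed.

Lemma near_exp_small (lambda C sigma : R) : 0 < lambda -> 0 < C -> 0 < sigma ->
  \forall t \near +oo, 0 <= t /\ expR (- (lambda * t)) * C < sigma.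
Proof.
move=> l0 C0 s0; near=> t; split; first by near: t; exact: nbhs_pinfty_ge.
have : C / sigma < 1 + lambda * t.
  rewrite -ltrBlDl -ltr_pdivrMl//; near: t; apply: nbhs_pinfty_gt.
  exact: num_real.
move=> /lt_le_trans /(_ (expR_ge1Dx _)).
rewrite ltr_pdivrMr// expRN => h.
by rewrite mulrC ltr_pdivrMr ?expR_gt0// mulrC.
Unshelve. all: by end_near. Qed.

End scalar_estimates.

(** * The realising network *)

(** Any solution starting in the image of X has a lift starting in X: translate
    a given lift by a constant deck transformation. *)
Lemma solution_lift (R : realType) m (G : torus R m -> 'I_m -> R) theta
    (X : set 'rV[R]_m) :
  solution G theta -> (@to_torus R m @` X) (theta 0) ->
  exists y : R -> 'I_m -> R,
    [/\ forall t, theta t = to_torus (\row_k y t k),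
        forall t k, is_derive t (1 : R) (fun s => y s k) (G (theta t) k) &
        X (\row_k y 0 k)].
Proof.
move=> [x [thE dx]] [v Xv v0].
pose y t k := x t k + (v 0 k - x 0 k).
exists y; split.
- move=> t; apply/funext => k.
  rewrite /to_torus mxE /y to_circleD to_circleB -!thE.
  by rewrite -v0 /to_torus subrr addr0.
- move=> t k; have dxk := dx t k.
  have := is_deriveD dxk (is_derive_cst (v 0 k - x 0 k) t 1).
  by rewrite addr0.
- rewrite (_ : \row_k _ = v)//; apply/rowP => k.
  by rewrite mxE /y addrC subrK.
Qed.

Section realisation.
Variables (R : realType) (n : nat) (omega : R) (H : rel 'I_n.+1).
Variables (r : 'I_n.+1) (par : 'I_n.+1 -> 'I_n.+1) (dep : 'I_n.+1 -> nat).
Hypothesis hH : irreflexive H.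
Hypothesis treeP : forall k, k != r -> H (par k) k /\ (dep (par k) < dep k)%N.
Implicit Types (x : 'I_n.+1 -> R) (i j k : 'I_n.+1).

(** A quarter of the separation of the offsets, as [cos_lt_other] requires. *)
Definition arc_radius : R := gap R n.+1 / 4.

Definition edges : pred ('I_n.+1 * 'I_n.+1) := fun e => H e.1 e.2.

Definition is_tree_edge j k := (k != r) && (j == par k).

Definition gain (e : 'I_n.+1 * 'I_n.+1) : R :=
  if is_tree_edge e.1 e.2 then 1 else tolerance R dep / 2.

Definition realiser : circle R -> R :=
  coupling edges (@offset R n.+1) gain arc_radius.

(* The radius on which the profile is linear up to the tolerance. *)
Variable rad : R.
Hypothesis rad_gt0 : 0 < rad.
Hypothesis rad_le : rad <= arc_radius.
Hypothesis radP : forall u, `|u| < rad ->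
  `|wave (cos arc_radius) u - u| <= tolerance R dep * `|u|.

Local Notation F := (network omega realiser).
Local Notation tol := (tolerance R dep).

Let depP k : k != r -> (dep (par k) < dep k)%N. Proof. by case/treeP. Qed.

Lemma arc_radius_small : 0 < arc_radius <= 2^-1.
Proof.
have g0 := gap_gt0 R n.+1; apply/andP; split; first by rewrite divr_gt0.
have : gap R n.+1 <= 1 by rewrite exprn_ile1// invf_le1// ler1n.
by rewrite /arc_radius; lra.
Qed.

Lemma edge_neq e : edges e -> e.1 != e.2.
Proof. by apply: contraTneq => e12; rewrite /edges e12 hH. Qed.

Lemma offset_arc_sep (e e' : 'I_n.+1 * 'I_n.+1) :
  e.1 != e.2 -> e'.1 != e'.2 -> e != e' ->
  4 * arc_radius <= `|offset R e - offset R e'|.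
Proof.
move=> e12 e'12 ee'; apply: le_trans (offset_sep R e12 e'12 ee').
by rewrite /arc_radius mulrC divfK.
Qed.

Lemma edges_sep e e' : edges e -> edges e' -> e != e' ->
  4 * arc_radius <= `|offset R e - offset R e'|.
Proof. by move=> /edge_neq e12 /edge_neq e'12; exact: offset_arc_sep. Qed.

Lemma gain_neq0 e : edges e -> gain e != 0.
Proof.
move=> _; rewrite /gain; case: ifP => // _.
by rewrite gt_eqF// divr_gt0// (tolerance_gt0 R r).
Qed.

Lemma realiser_coupling_function : (0 < n)%N -> coupling_function realiser.
Proof.
move=> n0; have [k kr] : exists k : 'I_n.+1, k != r.
  have [r0|r0] := eqVneq r ord0; last by exists ord0; rewrite eq_sym.
  by exists ord_max; rewrite r0 -val_eqE/= -lt0n.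
apply: (@coupling_is_coupling_function _ _ _ _ _ _ arc_radius_small
  (@offset_small _ _) edges_sep gain_neq0 (par k, k)).
exact: (treeP kr).1.
Qed.

(** The displacement of oscillator k from the locked state, relative to the root
    so that it is invariant under phase shifts. *)
Definition deviation x k : R := (x k - phase R k) - (x r - phase R r).

Definition level x : R := energy dep (deviation x).

(** Below this level all differences of deviations are less than [rad], so that
    the profiles are in their linear regime. *)
Definition max_level : R := min_weight R dep * (rad / 2) ^+ 2.

Lemma deviationB x j k :
  deviation x j - deviation x k = (x j - x k) - offset R (j, k).
Proof. by rewrite /deviation /offset/=; ring. Qed.

Lemma deviation_root x : deviation x r = 0.
Proof. exact: subrr. Qed.

Lemma deviation_lt x e : 0 < e -> level x < min_weight R dep * e ^+ 2 ->
  forall k, `|deviation x k| < e.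
Proof.
move=> e0 xe k; have mw0 : 0 < min_weight R dep by exact: (min_weight_gt0 R r).
have : deviation x k ^+ 2 < e ^+ 2.
  apply: le_lt_trans (sqr_le_energy r dep _ k) _.
  by rewrite ltr_pdivrMr// mulrC.
by rewrite -(real_normK (num_real (deviation x k))) ltr_pXn2r// nnegrE ltW.
Qed.

Lemma deviationB_lt x j k e : 0 < e ->
  level x < min_weight R dep * (e / 2) ^+ 2 ->
  `|deviation x j - deviation x k| < e.
Proof.
move=> e0 xe; have e20 : 0 < e / 2 by rewrite divr_gt0.
have := ler_normB (deviation x j) (deviation x k).
have := deviation_lt e20 xe j; have := deviation_lt e20 xe k; lra.
Qed.

Lemma max_level_gt0 : 0 < max_level.
Proof. by rewrite mulr_gt0 ?(min_weight_gt0 R r)// exprn_gt0// divr_gt0. Qed.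

(** Near the locked state, x_j - x_k is close to its offset, so it lies on the
    arc of the edge (j, k) if this edge exists, and on no other arc. *)
Lemma dead_in_basin x j k : level x < max_level -> j != k ->
  dead edges (@offset R n.+1) arc_radius (x j - x k) <-> ~~ H j k.
Proof.
move=> xlt jk; have := deviationB_lt j k rad_gt0 xlt; rewrite deviationB => xjk.
have [d0 d1] := andP arc_radius_small; have p2 := pi_ge2 R.
split=> [xdead|Hjk e ee].
  apply/negP => Hjk; have := xdead (j, k) Hjk; rewrite ltNge.
  rewrite cos_ge_near//; first lra.
  exact: le_trans (ltW xjk) rad_le.
have ne : (j, k) != e by apply: contraNneq Hjk => jkE; rewrite -jkE in ee.
apply: (cos_lt_other arc_radius_small (offset_small R (j, k))
  (offset_small R e)).
  exact: (@offset_arc_sep (j, k) e jk (edge_neq ee) ne).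
apply: le_trans (le_trans (ltW xjk) rad_le) _.
by rewrite ler_peMl ?ler1n// ltW.
Qed.

Lemma realiser_value x j k : level x < max_level -> j != k ->
  realiser (to_circle (x j) - to_circle (x k)) =
  if H j k
  then gain (j, k) * wave (cos arc_radius) (deviation x j - deviation x k)
  else 0.
Proof.
move=> xlt jk; rewrite -to_circleB /realiser coupling_to_circle.
case: ifPn => [Hjk|/(dead_in_basin xlt jk) xdead].
  rewrite deviationB; apply: (profile_near _ arc_radius_small
    (@offset_small _ _) edges_sep (i := (j, k))) => //.
  have := deviationB_lt j k rad_gt0 xlt; rewrite deviationB => xjk.
  apply: le_trans (le_trans (ltW xjk) rad_le) _.
  by case/andP: arc_radius_small => d0 _; rewrite ler_peMl ?ler1n// ltW.
by apply: profile_eq0 => e /xdead/ltW.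
Qed.

Lemma is_tree_edgeP j k : is_tree_edge j k -> H j k.
Proof. by case/andP => /treeP[Hk _] /eqP ->. Qed.

(** What the dynamics adds to the tree cascade: the nonlinearity on the tree
    edges, and the whole coupling on the other edges. *)
Definition error x k : R :=
  F (fun i => to_circle (x i)) k - omega -
  (if k == r then 0 else deviation x (par k) - deviation x k).

Lemma network_drift x k :
  F (fun i => to_circle (x i)) k =
  omega + drift r par (deviation x) (error x) k.
Proof.
by rewrite /drift /error [X in omega + X]addrC subrK addrC subrK.
Qed.

(** Edge by edge: on a tree edge the profile differs from the identity by a
    relative error [tolerance]; on another edge of H the gain is half the
    tolerance, and the profile is at most twice the identity. *)
Lemma error_le x k : level x < max_level ->
  `|error x k| <= tol * \sum_j `|deviation x j - deviation x k|.
Proof.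
move=> xlt; pose u j := deviation x j - deviation x k.
have -> : error x k = \sum_j
    ((if j != k then realiser (to_circle (x j) - to_circle (x k)) else 0) -
     (if is_tree_edge j k then u j else 0)).
  rewrite sumrB -big_mkcond -big_mkcond/= /error /network.
  rewrite [omega + _]addrC addrK.
  congr (_ - _); case: ifPn => kr.
    by rewrite big_pred0// => j; rewrite /is_tree_edge kr.
  by rewrite (eq_bigl (pred1 (par k))) ?big_pred1_eq// => j;
    rewrite /is_tree_edge kr.
rewrite mulr_sumr; apply: le_trans (ler_norm_sum _ _ _) _.
apply: ler_sum => j _; rewrite -/(u j).
have tol0 : 0 < tol := tolerance_gt0 R r dep.
have tol1 : tol <= 1 := tolerance_le1 R r dep.
have uj : `|u j| < rad := deviationB_lt j k rad_gt0 xlt.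
have wu := radP uj.
case: ifPn => [jk|]; last first.
  rewrite negbK => /eqP jk; rewrite sub0r normrN.
  case: ifPn => [|_]; last by rewrite normr0 mulr_ge0// ltW.
  by move/is_tree_edgeP; rewrite jk hH.
rewrite realiser_value// -/(u j) /gain/=.
case: (boolP (is_tree_edge j k)) => [tjk|_].
  by rewrite (is_tree_edgeP tjk) mul1r.
rewrite subr0; case: ifP => _; last by rewrite normr0 mulr_ge0// ltW.
have tol20 : 0 < tol / 2 by rewrite divr_gt0.
rewrite normrM gtr0_norm// -mulrA ler_wpM2l ?(ltW tol0)//.
have : `|wave (cos arc_radius) (u j)| <=
    `|wave (cos arc_radius) (u j) - u j| + `|u j|.
  by rewrite -{1}[wave _ (u j)](subrK (u j)) ler_normD.
have : tol * `|u j| <= `|u j| by rewrite ler_piMl.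
lra.
Qed.

(** Subtracting the same amount [h t] from all components covers both the
    network (h = 0) and its phase differences. *)
Lemma level_decay (y : R -> 'I_n.+1 -> R) (h : R -> R) :
  (forall t k, is_derive t (1 : R) (fun s => y s k)
    (F (fun i => to_circle (y t i)) k - h t)) ->
  level (y 0) < max_level ->
  forall t, 0 <= t -> level (y t) <= expR (- (4^-1 * t)) * level (y 0).
Proof.
move=> dy y0.
pose f t := level (y t).
pose df t := \sum_k weight R dep k * (2 * deviation (y t) k *
  (F (fun i => to_circle (y t i)) k - F (fun i => to_circle (y t i)) r)).
have dev_derive (t : R) k : is_derive t 1 (fun s => deviation (y s) k)
    (F (fun i => to_circle (y t i)) k - F (fun i => to_circle (y t i)) r).
  have dyk := dy t k; have dyr := dy t r.
  have dk := is_deriveB dyk (is_derive_cst (phase R k) t 1).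
  have dr := is_deriveB dyr (is_derive_cst (phase R r) t 1).
  have := is_deriveB dk dr.
  set a := F _ k; set b := F _ r => dd.
  have -> : a - b = a - h t - 0 - (b - h t - 0).
    by rewrite !subr0 opprB addrA subrK.
  exact: dd.
apply: (@exp_decay _ f df max_level) => //.
- move=> t.
  rewrite (_ : f =
      \sum_k (fun s => weight R dep k * deviation (y s) k ^+ 2)).
    rewrite /df; elim/big_ind2 : _ => [|f1 d1 f2 d2 h1 h2|k _].
    + exact: is_derive_cst.
    + exact: is_deriveD.
    + have dk := dev_derive t k.
      have := is_deriveZ (weight R dep k) (is_deriveM dk dk).
      rewrite /GRing.scale/= => d2; apply: is_derive_eq.
      by rewrite /GRing.scale/=; ring.
  by apply/funext => s; rewrite fct_sumE.
- by move=> t; exact: (energy_ge0 r).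
- move=> t yt.
  have := energy_decay depP (deviation_root (y t)) (fun k => error_le k yt).
  apply: le_trans; apply: ler_sum => k _.
  by rewrite !network_drift opprD addrACA subrr add0r.
Qed.

Lemma level_continuous : continuous (fun v : 'rV[R]_n.+1 => level (v 0)).
Proof.
have sumC (r' : seq 'I_n.+1) : continuous (fun v : 'rV[R]_n.+1 =>
    \sum_(k <- r') weight R dep k * deviation (v 0) k ^+ 2).
  elim: r' => [|k r' IHr].
    rewrite (_ : (fun v => _) = cst 0); first exact: cst_continuous.
    by apply/funext => v; rewrite big_nil.
  rewrite (_ : (fun v => _) = (fun v : 'rV[R]_n.+1 =>
      weight R dep k * (deviation (v 0) k * deviation (v 0) k) +
      \sum_(i <- r') weight R dep i * deviation (v 0) i ^+ 2)); last first.
    by apply/funext => v; rewrite big_cons expr2.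
  move=> v.
  have ck i :
      {for v, continuous (fun u : 'rV[R]_n.+1 => u 0 i - phase R i)}.
    exact: (continuousB (@coord_continuous R 1 n.+1 0 i v)
      (@cst_continuous _ _ (phase R i) v)).
  have dk := continuousB (ck k) (ck r).
  exact: (continuousD (continuousM (@cst_continuous _ _ (weight R dep k) v)
    (continuousM dk dk)) (IHr v)).
exact: sumC.
Qed.

Definition basin (s : R) : set (torus R n.+1) :=
  @to_torus R n.+1 @` [set v : 'rV[R]_n.+1 | level (v 0) < s].

Lemma basin_open s : open (basin s).
Proof.
apply: to_torus_open.
apply: (@open_comp _ _ (fun v : 'rV[R]_n.+1 => level (v 0)))
  (@open_lt _ s) => v _.
exact: level_continuous.
Qed.

Lemma level_row (x : 'I_n.+1 -> R) : level ((\row_k x k) 0) = level x.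
Proof. by congr level; apply/funext => k; rewrite mxE. Qed.

Lemma basin_to_torus s (v : 'rV[R]_n.+1) :
  level (v 0) < s -> basin s (to_torus v).
Proof. by move=> vs; exists v. Qed.

Lemma level_ge0 x : 0 <= level x. Proof. exact: (energy_ge0 r). Qed.

Lemma level_phase : level (fun k => phase R k) = 0.
Proof.
apply: big1 => k _; rewrite /deviation.
by rewrite (_ : _ - _ = 0) ?expr0n/= ?mulr0//; ring.
Qed.

Lemma basin_decay theta s : s <= max_level -> solution F theta ->
  basin s (theta 0) -> exists y : R -> 'rV[R]_n.+1,
    [/\ forall t, theta t = to_torus (y t), level (y 0 0) < s &
      forall t, 0 <= t ->
        level (y t 0) <= expR (- (4^-1 * t)) * level (y 0 0)].
Proof.
move=> sm sol b0; have [y [thE dy y0]] := solution_lift sol b0.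
exists (fun t => \row_k y t k); split => // t t0.
rewrite !level_row; apply: (@level_decay y (fun=> 0)) => //.
  move=> u k; have := dy u k; rewrite thE subr0.
  by rewrite (_ : to_torus _ = fun i => to_circle (y u i))//;
    apply/funext => i; rewrite /to_torus mxE.
by move: y0; rewrite /= level_row => /lt_le_trans; exact.
Qed.

Lemma decay_le_level (t a : R) :
  0 <= t -> 0 <= a -> expR (- (4^-1 * t)) * a <= a.
Proof.
by move=> t0 a0; rewrite ler_piMl// -expR0 ler_expR oppr_le0 mulr_ge0.
Qed.

Lemma basin_forward_invariant s :
  s <= max_level -> forward_invariant F (basin s).
Proof.
move=> sm theta sol b0 t t0; have [y [-> y0 yP]] := basin_decay sm sol b0.
apply: basin_to_torus; apply: le_lt_trans (yP t t0) (le_lt_trans _ y0).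
by rewrite decay_le_level ?level_ge0.
Qed.

Lemma basin_graph theta : basin max_level theta ->
  effective_graph realiser theta =2 H.
Proof.
move=> [v /= vlt <-] j k; rewrite /effective_graph.
case: (altP (j =P k)) => [->|jk] /=; first by rewrite hH.
have DZE := DZ_dead arc_radius_small (@offset_small R n.+1) edges_sep gain_neq0.
have deadE := dead_in_basin vlt jk.
rewrite /to_torus -to_circleB; apply/asboolP/idP => [nDZ|Hjk].
  by apply: contrapT => /negP/deadE/DZE.
by move=> /DZE/deadE; rewrite Hjk.
Qed.

Lemma max_level_lt1 : max_level < min_weight R dep * 1 ^+ 2.
Proof.
have [_ d1] := andP arc_radius_small.
rewrite ltr_pM2l ?(min_weight_gt0 R r)// expr1n.
rewrite expr_lt1 ?divr_ge0 ?(ltW rad_gt0)//.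
by move: rad_le; lra.
Qed.

(** Deviations change by at most 2 e, and they are bounded by 1. *)
Lemma level_perturb x (y : 'I_n.+1 -> R) e : 0 <= e <= 1 ->
  (forall k, `|deviation x k| <= 1) -> (forall k, `|y k - x k| <= e) ->
  level y <= level x + n.+1%:R * (8 * e).
Proof.
move=> /andP[e0 e1] dx yx.
have -> : n.+1%:R * (8 * e) = \sum_(k < n.+1) 8 * e.
  by rewrite sumr_const card_ord mulr_natl.
rewrite -big_split/=.
apply: ler_sum => k _; set w := weight _ _ _.
have w0 : 0 < w := weight_gt0 R r dep k.
have w1 : w <= 1 := weight_le1 R r dep k.
have dd : `|deviation y k - deviation x k| <= 2 * e.
  rewrite (_ : _ - _ = (y k - x k) - (y r - x r)); last first.
    by rewrite /deviation; ring.
  by apply: le_trans (ler_normB _ _) _; have := yx k; have := yx r; lra.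
have sq : deviation y k ^+ 2 <= deviation x k ^+ 2 + 8 * e.
  move: dd (dx k); rewrite !ler_norml => /andP[h1 h2] /andP[h3 h4].
  by nra.
apply: le_trans (ler_wpM2l (ltW w0) sq) _; rewrite mulrDr lerD2l.
by rewrite ler_piMl// mulr_ge0.
Qed.

(** A point of the closure has a lift arbitrarily close to a lift of a point of
    the basin, and the energy is uniformly continuous on the basin. *)
Lemma closure_basin_sub s s' : s < s' -> s <= max_level ->
  closure (basin s) `<=` basin s'.
Proof.
move=> ss' sm theta; have [v <-] := to_torus_surj theta => vcl.
(* the loss in [level_perturb] is then at most s' - s *)
pose e := Num.min 1 ((s' - s) / (n.+1%:R * 8)).
have e0 : 0 < e.
  by rewrite lt_min ltr01 divr_gt0 ?subr_gt0// mulr_gt0.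
have [_ [[u /= us <-] [v' vv' uv']]] :=
  vcl _ (nbhs_to_torus (nbhsx_ballx v e e0)).
exists (u - v' + v); last exact: to_torus_eq_shift.
have pert : level ((u - v' + v) 0) <= level (u 0) + n.+1%:R * (8 * e).
  apply: level_perturb; first by rewrite (ltW e0) ge_min lexx.
    move=> k; apply/ltW/deviation_lt => //.
    exact: lt_trans (lt_le_trans us sm) max_level_lt1.
  move=> k; have [_ /(_ 0 k)] := vv'; rewrite /ball/= => /ltW.
  rewrite (_ : (u - v' + v) 0 k - u 0 k = v 0 k - v' 0 k)//.
  by rewrite !mxE; ring.
apply: le_lt_trans pert _; apply: lt_le_trans (ltr_leD us (lexx _)) _.
rewrite -lerBrDl mulrA -ler_pdivlMl ?mulr_gt0// mulrC.
by rewrite /e ge_min lexx orbT.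
Qed.

(** Contracting the deviations towards the locked state lowers the energy
    strictly, so points of level s are limits of points of the basin. *)
Lemma closure_basin s (v : 'rV[R]_n.+1) : 0 < s -> level (v 0) <= s ->
  closure (basin s) (to_torus v).
Proof.
move=> s0 vs W /to_torus_continuous Wv.
pose u : 'rV[R]_n.+1 := \row_k deviation (v 0) k.
have cu : (v - tau *: u) @[tau --> (0 : R)] --> v - 0 *: u.
  apply: cvgB; first exact: cvg_cst.
  by apply: cvgZr_tmp; exact: cvg_id.
rewrite scale0r subr0 in cu.
have /nbhs_ballP[e /= e0 eP] := cu _ Wv.
pose tau := Num.min (e / 2) 2^-1.
have tau0 : 0 < tau by rewrite lt_min divr_gt0// invr_gt0 ltr0n.
have tau1 : tau <= 2^-1 by rewrite ge_min lexx orbT.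
have taue : tau < e by rewrite gt_min; apply/orP; left; lra.
exists (to_torus (v - tau *: u)); split; last first.
  by apply: eP; rewrite /ball/= sub0r normrN gtr0_norm.
apply: basin_to_torus.
have -> : level ((v - tau *: u) 0) = (1 - tau) ^+ 2 * level (v 0).
  rewrite /level /energy mulr_sumr; apply: eq_bigr => k _.
  by rewrite /deviation !mxE /deviation; ring.
apply: le_lt_trans (ler_wpM2l (sqr_ge0 _) vs) _.
by rewrite gtr_pMl// expr_lt1//; lra.
Qed.

Lemma level_shift x c : level (fun k => x k + c) = level x.
Proof.
by apply: eq_bigr => k _; rewrite /deviation; congr (_ * _ ^+ 2); ring.
Qed.

Lemma basin_lift s theta : basin s theta -> exists v : 'rV[R]_n.+1,
  [/\ to_torus v = theta, level (v 0) < s & `|v 0 r| <= pi].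
Proof.
move=> [v /= vs <-]; have [x xE xpi] := circle_lift (to_circle (v 0 r)).
have [m xm] : exists m : int, x = v 0 r + m%:~R * (2 * pi).
  exact/to_circle_eqP.
exists (\row_k (v 0 k + m%:~R * (2 * pi))); split.
- by apply/funext => k; rewrite /to_torus mxE; apply/to_circle_eqP; exists m.
- by rewrite level_row level_shift.
- by rewrite mxE -xm.
Qed.

(** Up to a common phase shift by a multiple of 2 pi, the lifts to consider form
    a compact set. On its part that projects outside U the energy attains a
    minimum, which exceeds s because lifts of level at most s project to the
    closure of the basin. *)
Lemma basin_tube U s : open U -> closure (basin s) `<=` U ->
  0 < s < max_level -> exists2 s', s < s' <= max_level & basin s' `<=` U.
Proof.
move=> oU sU /andP[s0 sm].
pose K : set 'rV[R]_n.+1 := [set v : 'rV[R]_n.+1 | `|v 0 r| <= pi] `&`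
  ([set v : 'rV[R]_n.+1 | level (v 0) <= max_level] `&`
   @to_torus R n.+1 @^-1` ~` U).
have inK s' theta : s' <= max_level -> basin s' theta -> ~ U theta ->
    exists2 v, K v & level (v 0) < s'.
  move=> s'm /basin_lift[v [<- vs vpi]] nU; exists v => //.
  by split => //; split => //=; exact: ltW (lt_le_trans vs s'm).
have clK : closed K.
  apply: closedI; last apply: closedI.
  - apply: (@closed_comp _ _ (fun v : 'rV[R]_n.+1 => `|v 0 r|)
      [set y | y <= pi]).
      by move=> v _; apply: continuous_comp; [exact: coord_continuous|
        exact: norm_continuous].
    exact: closed_le.
  - apply: (@closed_comp _ _ (fun v : 'rV[R]_n.+1 => level (v 0))
      [set y | y <= max_level]); last exact: closed_le.
    by move=> v _; exact: level_continuous.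
  - apply: closed_comp; last exact: open_closedC.
    by move=> v _; exact: to_torus_continuous.
have bK : bounded_set K.
  exists (pi + 3); split; first exact: num_real.
  move=> M piM v [vpi [vm _]].
  have piM0 : 0 <= M by apply: le_trans (ltW piM); rewrite addr_ge0 ?pi_ge0.
  rewrite /= [leLHS]/Num.Def.normr /= mx_normrE.
  apply: bigmax_le => //= -[i k] _ /=.
  rewrite ord1; apply: le_trans (ltW piM).
  have := deviation_lt ltr01 (le_lt_trans vm max_level_lt1) k.
  have /andP[p1 p2] := phase_bound R k; have /andP[p3 p4] := phase_bound R r.
  move: vpi; rewrite /= /deviation !ler_norml !ltr_norml.
  move=> /andP[h1 h2] /andP[h3 h4]; apply/andP; split; lra.
have [K0|/set0P K0] := eqVneq K set0.
  exists max_level; first by rewrite sm lexx.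
  move=> theta bt; apply: contrapT => nU.
  by have [v] := inK _ _ (lexx _) bt nU; rewrite K0.
have cK : {within K, continuous (fun v : 'rV[R]_n.+1 => level (v 0))}.
  by apply: continuous_subspaceT; exact: level_continuous.
have [c cKin cmin] := EVT_min_rV K0 (bounded_closed_compact bK clK) cK.
have [_ [cm ncU]] : K c by rewrite inE in cKin.
exists (level (c 0)).
  rewrite cm andbT ltNge; apply/negP => cs; apply: ncU; apply: sU.
  exact: closure_basin.
move=> theta bt; apply: contrapT => nU.
have [v vK] := inK _ _ cm bt nU.
by rewrite ltNge cmin// inE.
Qed.

Lemma realiser_stably_realises : stably_realises omega realiser H.
Proof.
have m0 := max_level_gt0; pose s := max_level / 2.
have s0 : 0 < s by rewrite divr_gt0.
have sm : s < max_level by rewrite /s; lra.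
exists (basin s); split.
- exists (to_torus (\row_k phase R k)); apply: basin_to_torus.
  by rewrite level_row level_phase.
- exact: basin_open.
- exact/basin_forward_invariant/ltW.
- split=> [U oU sU|].
    have [|s' /andP[ss' s'm] s'U] := basin_tube oU sU; first by rewrite s0.
    exists (basin s'); split; first exact: basin_open.
      exact/closure_basin_sub/ltW.
    move=> theta sol b0 t t0; apply: s'U.
    exact: (basin_forward_invariant s'm sol b0 t0).
  exists (basin max_level); split; first exact: basin_open.
    exact/closure_basin_sub/ltW.
  move=> theta sol b0 U oU sU.
  have [y [thE y0 yP]] := basin_decay (lexx _) sol b0.
  near=> t; apply: sU; apply: subset_closure; rewrite thE.
  apply: basin_to_torus.
  have [t0 ts] : 0 <= t /\ expR (- (4^-1 * t)) * max_level < s.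
    by near: t; apply: near_exp_small.
  apply: le_lt_trans (yP t t0) (le_lt_trans _ ts).
  by rewrite ler_wpM2l ?expR_ge0// ltW.
- move=> theta [v /= vs <-]; apply: basin_graph.
  by apply: basin_to_torus; exact: lt_trans sm.
Unshelve. all: by end_near. Qed.

(** The lift of [phase_section]: phase differences are embedded as phases with
    first component 0. *)
Definition section_lift (y : 'I_n -> R) i : R :=
  if unlift ord0 i is Some l then y l else 0.

Lemma phase_section_to_circle (y : 'I_n -> R) :
  phase_section (fun l => to_circle (y l)) =
  (fun i => to_circle (section_lift y i)) :> torus R n.+1.
Proof.
apply/funext => i; rewrite /phase_section /section_lift.
by case: (unlift ord0 i) => //; rewrite /to_circle raddf0.
Qed.

Definition locked_phases : torus R n.+1 := fun k => to_circle (phase R k).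

Definition locked_diff (l : 'I_n) : R :=
  phase R (lift ord0 l) - phase R (@ord0 n).

Lemma phase_diff_locked :
  phase_diff locked_phases = to_torus (\row_l locked_diff l).
Proof.
by apply/funext => k; rewrite /to_torus mxE /phase_diff -to_circleB.
Qed.

Lemma section_lift_locked i :
  section_lift locked_diff i = phase R i + - phase R (@ord0 n).
Proof.
by rewrite /section_lift; case: unliftP => [k ->|->] //; rewrite subrr.
Qed.

Lemma level_locked : level (section_lift locked_diff) = 0.
Proof.
have -> : section_lift locked_diff = fun i => phase R i + - phase R (@ord0 n).
  by apply/funext => i; exact: section_lift_locked.
by rewrite level_shift level_phase.
Qed.

Definition quotient_basin (s : R) : set (torus R n) :=
  @to_torus R n @` [set v : 'rV[R]_n | level (section_lift (v 0)) < s].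

Lemma quotient_basin_open s : s <= max_level -> open (quotient_basin s).
Proof.
move=> sm; apply: to_torus_open; rewrite openE => v /= vs.
(* 16 is twice the constant of [level_perturb], to get a strict inequality *)
pose e := Num.min 1 ((s - level (section_lift (v 0))) / (n.+1%:R * 16)).
have e0 : 0 < e by rewrite lt_min ltr01 divr_gt0 ?subr_gt0// mulr_gt0.
apply/nbhs_ballP; exists e => // u [_ vu] /=.
have pert : level (section_lift (u 0)) <=
    level (section_lift (v 0)) + n.+1%:R * (8 * e).
  apply: level_perturb; first by rewrite (ltW e0) ge_min lexx.
    move=> k; apply/ltW/deviation_lt => //.
    exact: lt_trans (lt_le_trans vs sm) max_level_lt1.
  move=> i; rewrite /section_lift; case: unliftP => [k _|_].
    by have := vu 0 k; rewrite /ball/= distrC => /ltW.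
  by rewrite subrr normr0 ltW.
apply: le_lt_trans pert _; rewrite -ltrBrDl.
have : e <= (s - level (section_lift (v 0))) / (n.+1%:R * 16).
  by rewrite /e ge_min lexx orbT.
rewrite ler_pdivlMr ?mulr_gt0//; apply: lt_le_trans.
rewrite [ltRHS]mulrC -mulrA ltr_pM2l// ltr_pM2r//.
by rewrite ltr_nat.
Qed.

Lemma quotient_decay psi s : s <= max_level ->
  solution (quotient_field F) psi -> quotient_basin s (psi 0) ->
  exists y : R -> 'rV[R]_n,
    [/\ forall t, psi t = to_torus (y t),
      level (section_lift (y 0 0)) < s &
      forall t, 0 <= t -> level (section_lift (y t 0)) <=
        expR (- (4^-1 * t)) * level (section_lift (y 0 0))].
Proof.
move=> sm sol b0; have [y [thE dy y0]] := solution_lift sol b0.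
have rowE t : (\row_l y t l) 0 = y t by apply/funext => l; rewrite mxE.
exists (fun t => \row_l y t l); split => // t t0; rewrite !rowE.
pose x u := section_lift (y u).
apply: (@level_decay x (fun u => F (fun i => to_circle (x u i)) ord0)) => //.
  move=> u i; have psiE : psi u = fun l => to_circle (y u l).
    by rewrite thE; apply/funext => k; rewrite /to_torus mxE.
  rewrite /x /section_lift; case: unliftP => [k ->|->]; last first.
    by rewrite subrr; exact: is_derive_cst.
  have := dy u k; rewrite psiE /quotient_field phase_section_to_circle.
  exact.
by move: y0; rewrite /= rowE => /lt_le_trans; exact.
Qed.

Lemma quotient_basin_small (U : set (torus R n)) : open U ->
  U (phase_diff locked_phases) ->
  exists2 s, 0 < s <= max_level & quotient_basin s `<=` U.
Proof.
move=> oU; rewrite phase_diff_locked => Uq.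
have /nbhs_ballP[e /= e0 eP] :=
  to_torus_continuous (open_nbhs_nbhs (conj oU Uq)).
pose s := Num.min max_level (min_weight R dep * (e / 2) ^+ 2).
have s0 : 0 < s.
  rewrite lt_min max_level_gt0 mulr_gt0 ?(min_weight_gt0 R r)//.
  by rewrite exprn_gt0// divr_gt0.
exists s; first by rewrite s0 ge_min lexx.
move=> _ [v /= vs <-]; apply: eP; split => // i k; rewrite !ord1 mxE.
have ve : level (section_lift (v 0)) < min_weight R dep * (e / 2) ^+ 2.
  by apply: lt_le_trans vs _; rewrite ge_min lexx orbT.
have := deviationB_lt (lift ord0 k) ord0 e0 ve.
rewrite deviationB /section_lift liftK unlift_none subr0 /offset/=.
by rewrite /ball/= distrC.
Qed.

Lemma network_locked (c : R) k :
  F (fun i => to_circle (phase R i + c)) k = omega.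
Proof.
rewrite /network big1 ?addr0// => j jk; rewrite -to_circleB.
have -> : phase R j + c - (phase R k + c) = phase R j - phase R k by ring.
have lvl : level (fun i => phase R i) < max_level.
  by rewrite level_phase max_level_gt0.
rewrite to_circleB (realiser_value lvl jk).
have -> : deviation (fun i => phase R i) j -
    deviation (fun i => phase R i) k = 0.
  by rewrite deviationB subrr.
by rewrite wave0 mulr0 if_same.
Qed.

Lemma locked_relative_equilibrium :
  relative_equilibrium F omega locked_phases.
Proof.
exists (fun t k => omega * t + phase R k); split.
  by move=> t k; rewrite to_circleD.
move=> t k; have -> : (fun i => to_circle (omega * t) + locked_phases i) =
    (fun i => to_circle (phase R i + omega * t)) :> torus R n.+1.
  by apply/funext => i; rewrite /locked_phases -to_circleD addrC.
rewrite network_locked.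
have := is_deriveD (is_deriveZ omega (is_derive_id t 1))
  (is_derive_cst (phase R k) t 1).
by rewrite /GRing.scale/= mulr1 addr0.
Qed.

Lemma locked_asymptotically_stable :
  asymptotically_stable_equilibrium (quotient_field F)
    (phase_diff locked_phases).
Proof.
have locked_in s : 0 < s -> quotient_basin s (phase_diff locked_phases).
  move=> s0; rewrite phase_diff_locked; exists (\row_l locked_diff l) => //=.
  rewrite (_ : (\row_k _) 0 = locked_diff) ?level_locked//.
  by apply/funext => k; rewrite mxE.
have single (V : set (torus R n)) : [set phase_diff locked_phases] `<=` V <->
    V (phase_diff locked_phases) by split=> [|? _ ->//]; apply.
split; last split.
- move=> k; rewrite /quotient_field.
  have -> : phase_section (phase_diff locked_phases) =
      (fun i => to_circle (phase R i + - phase R (@ord0 n))) :> torus R n.+1.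
    have -> : phase_diff locked_phases = fun l => to_circle (locked_diff l).
      by apply/funext => j; rewrite /phase_diff /locked_diff to_circleB.
    rewrite phase_section_to_circle; apply/funext => i.
    by rewrite section_lift_locked.
  by rewrite !network_locked subrr.
- move=> U oU /single Uq.
  have [s /andP[s0 sm] sU] := quotient_basin_small oU Uq.
  exists (quotient_basin s); split; first exact: quotient_basin_open.
    exact/single/locked_in.
  move=> psi sol b0 t t0; have [y [psiE y0 yP]] := quotient_decay sm sol b0.
  apply: sU; rewrite psiE; exists (y t) => //=.
  apply: le_lt_trans (yP t t0) (le_lt_trans _ y0).
  by rewrite decay_le_level ?level_ge0.
- exists (quotient_basin max_level); split; first exact: quotient_basin_open.
    exact/single/locked_in/max_level_gt0.
  move=> psi sol b0 U oU /single Uq.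
  have [s /andP[s0 sm] sU] := quotient_basin_small oU Uq.
  have [y [psiE y0 yP]] := quotient_decay (lexx _) sol b0.
  near=> t; apply: sU; rewrite psiE; exists (y t) => //=.
  have [t0 ts] : 0 <= t /\ expR (- (4^-1 * t)) * max_level < s.
    by near: t; apply: near_exp_small => //; exact: max_level_gt0.
  apply: le_lt_trans (yP t t0) (le_lt_trans _ ts).
  by rewrite ler_wpM2l ?expR_ge0// ltW.
Unshelve. all: by end_near. Qed.

Lemma locked_graph : effective_graph realiser locked_phases =2 H.
Proof.
apply: basin_graph; exists (\row_k phase R k) => /=.
  by rewrite level_row level_phase max_level_gt0.
by apply/funext => k; rewrite /to_torus mxE.
Qed.

End realisation.

Theorem proposition8 (R : realType) (n : nat) (hN : (2 <= n.+1)%N) (omega : R)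
    (H : rel 'I_n.+1) (hH : irreflexive H)
    (htree : exists A : rel 'I_n.+1, spanning_diverging_tree H A) :
  exists g : circle R -> R,
    [/\ coupling_function g,
        exists (Omega : R) (theta0 : torus R n.+1),
          stable_relative_equilibrium (network omega g) Omega theta0 /\
          effective_graph g theta0 =2 H
      & stably_realises omega g H].
Proof.
have [A /diverging_tree_parent[r [par [dep treeP]]]] := htree.
have ar := arc_radius_small R n; have [ar0 _] := andP ar.
have [_ a1] := andP (cos_small ar).
have [e e0 eP] := linear_approx (wave0 (cos (arc_radius R n)))
  (is_derive_wave0 a1) (tolerance_gt0 R r dep).
pose rad := Num.min e (arc_radius R n).
have rad0 : 0 < rad by rewrite lt_min e0.
have rad_le : rad <= arc_radius R n by rewrite ge_min lexx orbT.
have radP u : `|u| < rad -> `|wave (cos (arc_radius R n)) u - u| <=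
    tolerance R dep * `|u|.
  by rewrite lt_min => /andP[/eP].
exists (realiser H r par dep); split.
- exact: realiser_coupling_function.
- exists omega, (@locked_phases R n); split; first split.
  + exact: (locked_relative_equilibrium omega r par dep hH rad0 rad_le).
  + exact: (locked_asymptotically_stable omega hH treeP rad0 rad_le radP).
  + exact: (locked_graph r par dep hH rad0 rad_le).
- exact: (realiser_stably_realises omega hH treeP rad0 rad_le radP).
Qed.
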